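(* The group $(F_4)^{\sigma_3}\cap(F_4)^{w_3}$ is isomorphic to $(SU(3)\times U(1)\times U(1))/\mathbb{Z}_3$, where $\mathbb{Z}_3=\{(E,1,1),(\boldsymbol{\omega}E,\boldsymbol{\omega},\boldsymbol{\omega}),(\boldsymbol{\omega}^{-1}E,\boldsymbol{\omega}^{-1},\boldsymbol{\omega}^{-1})\}$.
   Context: Let $\mathbf{H}$ be the quaternions with units $e_1,e_2,e_3=e_1e_2$, and $\mathbf{C}=\{x+ye_1: x,y\in\mathbb{R}\}\subset\mathbf{H}$. Let $\mathfrak{C}=\mathbf{H}\oplus\mathbf{H}e_4$ be the division Cayley algebra with multiplication $(m+ne_4)(p+qe_4)=(mp-\bar q n)+(n\bar p+qm)e_4$ and conjugation $\overline{m+ne_4}=\bar m-ne_4$. Let $\mathfrak{J}=\{X\in M(3,\mathfrak{C}): X^*=X\}$ be the exceptional Jordan algebra, with $X\circ Y=\tfrac12(XY+YX)$; its elements are $$X=\begin{pmatrix}\xi_1&x_3&\overline{x_2}\\ \overline{x_3}&\xi_2&x_1\\ x_2&\overline{x_1}&\xi_3\end{pmatrix},\quad \xi_i\in\mathbb{R},\ x_i\in\mathfrak{C}.$$ Put $F_4=\{\alpha\in\mathrm{Iso}_{\mathbb{R}}(\mathfrak{J}):\alpha(X\circ Y)=\alpha X\circ\alpha Y\}$, where $\mathrm{Iso}_{\mathbb{R}}$ denotes $\mathbb{R}$-linear isomorphisms. Let $\boldsymbol{\omega}=-\tfrac12+\tfrac{\sqrt3}{2}e_1\in\mathbf{C}$.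 Let $\sigma_3\in F_4$ be the map fixing each $\xi_i$ and sending $x_1\mapsto\bar{\boldsymbol{\omega}}x_1\bar{\boldsymbol{\omega}}$, $x_2\mapsto\boldsymbol{\omega}x_2$, $x_3\mapsto x_3\boldsymbol{\omega}$. Write $\mathfrak{C}=\mathbf{C}\oplus\mathbf{C}^3$ with $\mathbf{C}^3=\mathbf{C}e_2\oplus\mathbf{C}e_4\oplus\mathbf{C}e_6$ (where $e_6=\pm e_2e_4$; the sign is irrelevant) the orthogonal complement of $\mathbf{C}$, and let $w_3(m_0+\mathbf{m})=m_0+\boldsymbol{\omega}\mathbf{m}$ on $\mathfrak{C}$; it is extended to $w_3\in F_4$ by fixing each $\xi_i$ and acting on each $x_i$. For $g\in F_4$, $(F_4)^g=\{\alpha\in F_4: g^{-1}\alpha g=\alpha\}$. $U(1)$ and $SU(3)$ are taken over the complex field $\mathbf{C}$; $E$ is the unit matrix. *)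

(* Defs.v *)
From HB Require Import structures.
From mathcomp Require Import all_boot all_order all_algebra complex.
From mathcomp Require Import boolp reals ring.

Set Implicit Arguments.
Unset Strict Implicit.
Unset Printing Implicit Defensive.

Import Order.TTheory GRing.Theory Num.Theory.
Local Open Scope ring_scope.

Definition isomorphic (G H : groupType) : Prop :=
  exists f : {multiplicative G -> H}, bijective f.

Section Subgroups.
Variables (G : groupType).
Local Open Scope group_scope.

Definition subgrp (S : groupClosed G) := {x : G | x \in (S : {pred G})}.

Section SubgrpInstance.
Variable S : groupClosed G.
HB.instance Definition _ := SubChoice.on (subgrp S).
Fact subgrp_closed : group_closed (fun x => x \in (S : {pred G})).
Proof. by split=> [|x y xS yS]; [exact: gpred1 | exact: gpredF]. Qed.
HB.instance Definition _ :=
  SubChoice_isSubGroup.Build _ _ (subgrp S) subgrp_closed.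
End SubgrpInstance.

Definition centr (g : G) : {pred G} := fun a => g^-1 * a * g == a.

Fact centrE g a : (a \in centr g) = (a * g == g * a).
Proof.
rewrite unfold_in; apply/eqP/eqP => e; last by rewrite -mulgA e mulgA mulVg mul1g.
by rewrite -{2}e !mulgA mulgV mul1g.
Qed.

Section CentrInstance.
Variable g : G.
Fact centrM : mulg_closed (centr g).
Proof.
move=> x y; rewrite !centrE => /eqP xg /eqP yg.
by rewrite -mulgA yg mulgA xg mulgA.
Qed.
Fact centr1 : 1 \in centr g.
Proof. by rewrite centrE mulg1 mul1g. Qed.
Fact centrV : invg_closed (centr g).
Proof.
move=> x; rewrite !centrE => /eqP xg; apply/eqP.
by apply: (mulgI x); rewrite !mulgA mulgV mul1g xg -mulgA mulgV mulg1.
Qed.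
HB.instance Definition _ := isMulClosed.Build G (centr g) centrM.
HB.instance Definition _ := isMul1Closed.Build G (centr g) centr1.
HB.instance Definition _ := isInvClosed.Build G (centr g) centrV.
End CentrInstance.

Definition capg (A B : groupClosed G) : {pred G} :=
  fun x => (x \in (A : {pred G})) && (x \in (B : {pred G})).

Section CapInstance.
Variables A B : groupClosed G.
Fact capgM : mulg_closed (capg A B).
Proof. by move=> x y /andP[? ?] /andP[? ?]; apply/andP; split; apply: gpredM. Qed.
Fact capg1 : 1 \in capg A B.
Proof. by apply/andP; split; apply: gpred1. Qed.
Fact capgV : invg_closed (capg A B).
Proof. by move=> x /andP[? ?]; apply/andP; split; apply: gpredVr. Qed.
HB.instance Definition _ := isMulClosed.Build G (capg A B) capgM.
HB.instance Definition _ := isMul1Closed.Build G (capg A B) capg1.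
HB.instance Definition _ := isInvClosed.Build G (capg A B) capgV.
End CapInstance.

End Subgroups.

HB.mixin Record isNormalSub (G : groupType) (N : {pred G}) := {
  gpredNJ : forall x y, x \in N -> (x ^ y)%g \in N
}.
#[short(type="normalClosed")]
HB.structure Definition NormalClosed (G : groupType) :=
  {N of isNormalSub G N & GroupClosed G N}.

Section Quotient.
Variables (G : groupType) (N : normalClosed G).
Local Open Scope group_scope.
Local Open Scope quotient_scope.

Definition coset_rel : rel G := fun x y => x^-1 * y \in (N : {pred G}).

Fact coset_rel_refl : reflexive coset_rel.
Proof. by move=> x; rewrite /coset_rel mulVg gpred1. Qed.
Fact coset_rel_sym : symmetric coset_rel.
Proof. by move=> x y; rewrite /coset_rel -gpredV invgM invgK. Qed.
Fact coset_rel_trans : transitive coset_rel.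
Proof.
move=> y x z xy yz; rewrite /coset_rel.
have -> : x^-1 * z = (x^-1 * y) * (y^-1 * z) by rewrite !mulgA mulgK.
exact: gpredM.
Qed.
Canonical coset_equiv :=
  EquivRel coset_rel coset_rel_refl coset_rel_sym coset_rel_trans.

Definition quotg := {eq_quot coset_equiv}.
HB.instance Definition _ := Choice.on quotg.
HB.instance Definition _ := EqQuotient.on quotg.

Definition quotg_mul (x y : quotg) : quotg := \pi_quotg (repr x * repr y).
Definition quotg_one : quotg := \pi_quotg 1.
Definition quotg_inv (x : quotg) : quotg := \pi_quotg (repr x)^-1.

Lemma quotg_eqE (x y : G) :
  (\pi_quotg x == \pi_quotg y) = (x^-1 * y \in (N : {pred G})).
Proof. by rewrite eqmodE. Qed.

Lemma repr_coset (x : G) : (repr (\pi_quotg x))^-1 * x \in (N : {pred G}).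
Proof. by rewrite -quotg_eqE reprK. Qed.

Lemma quotg_mulE (x y : G) :
  quotg_mul (\pi_quotg x) (\pi_quotg y) = \pi_quotg (x * y).
Proof.
apply/eqP; rewrite quotg_eqE invgM.
set x' := repr (\pi x); set y' := repr (\pi y).
have -> : y'^-1 * x'^-1 * (x * y) = (x'^-1 * x) ^ y' * (y'^-1 * y).
  by rewrite /conjg !mulgA mulgK.
by apply: gpredM; [apply: gpredNJ|]; apply: repr_coset.
Qed.

Lemma quotg_invE (x : G) : quotg_inv (\pi_quotg x) = \pi_quotg x^-1.
Proof.
apply/eqP; rewrite quotg_eqE invgK; set x' := repr _.
have -> : x' * x^-1 = ((x'^-1 * x)^-1) ^ x'^-1.
  by rewrite /conjg invgM !invgK -!mulgA mulgV mulg1.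
by apply: gpredNJ; rewrite gpredV; apply: repr_coset.
Qed.

Fact quotg_mulA : associative quotg_mul.
Proof.
move=> x y z; rewrite -[x]reprK -[y]reprK -[z]reprK.
rewrite (quotg_mulE (repr y)) (quotg_mulE (repr x) (repr y)).
by rewrite !quotg_mulE mulgA.
Qed.
Fact quotg_1mul : left_id quotg_one quotg_mul.
Proof. by move=> x; rewrite -[x]reprK quotg_mulE mul1g. Qed.
Fact quotg_mul1 : right_id quotg_one quotg_mul.
Proof. by move=> x; rewrite -[x]reprK quotg_mulE mulg1. Qed.
Fact quotg_Vmul : left_inverse quotg_one quotg_inv quotg_mul.
Proof. by move=> x; rewrite -[x]reprK quotg_invE quotg_mulE mulVg. Qed.
Fact quotg_mulV : right_inverse quotg_one quotg_inv quotg_mul.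
Proof. by move=> x; rewrite -[x]reprK quotg_invE quotg_mulE mulgV. Qed.

HB.instance Definition _ := isGroup.Build quotg
  quotg_mulA quotg_1mul quotg_mul1 quotg_Vmul quotg_mulV.

End Quotient.

Section LinearAutomorphisms.
Variables (R : pzRingType) (V : lmodType R).

Record linAut := LinAut {
  linAut_fun :> V -> V;
  linAut_linear : linear linAut_fun;
  linAut_bij : bijective linAut_fun }.

Lemma linAutP (a b : linAut) : a =1 b -> a = b.
Proof.
case: a b => [f fl fb] [g gl gb] /= /funext fg.
by case: g / fg gl gb => gl gb; congr LinAut; apply: Prop_irrelevance.
Qed.

HB.instance Definition _ := gen_eqMixin linAut.
HB.instance Definition _ := gen_choiceMixin linAut.

Fact comp_linear (a b : linAut) : linear (a \o b).
Proof. by move=> k x y; rewrite /= linAut_linear linAut_linear. Qed.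
Definition linAut_mul (a b : linAut) : linAut :=
  LinAut (@comp_linear a b) (bij_comp (linAut_bij a) (linAut_bij b)).

Fact id_linear : linear (@id V). Proof. by []. Qed.
Definition linAut_one : linAut :=
  LinAut id_linear (Bijective (fun=> erefl) (fun=> erefl)).

Fact linAut_invP (a : linAut) : exists g, cancel a g /\ cancel g a.
Proof. by case: (linAut_bij a) => g ag ga; exists g. Qed.
Definition linAut_inv_fun (a : linAut) : V -> V := sval (cid (linAut_invP a)).
Lemma linAut_funK (a : linAut) : cancel a (linAut_inv_fun a).
Proof. by case: (svalP (cid (linAut_invP a))). Qed.
Lemma linAut_inv_funK (a : linAut) : cancel (linAut_inv_fun a) a.
Proof. by case: (svalP (cid (linAut_invP a))). Qed.
Fact linAut_inv_linear (a : linAut) : linear (linAut_inv_fun a).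
Proof.
move=> k x y; apply: (can_inj (linAut_funK a)).
by rewrite linAut_linear !linAut_inv_funK.
Qed.
Definition linAut_inv (a : linAut) : linAut :=
  LinAut (@linAut_inv_linear a)
    (Bijective (linAut_inv_funK a) (linAut_funK a)).

Fact linAut_mulA : associative linAut_mul.
Proof. by move=> a b c; apply: linAutP. Qed.
Fact linAut_1mul : left_id linAut_one linAut_mul.
Proof. by move=> a; apply: linAutP. Qed.
Fact linAut_mul1 : right_id linAut_one linAut_mul.
Proof. by move=> a; apply: linAutP. Qed.
Fact linAut_Vmul : left_inverse linAut_one linAut_inv linAut_mul.
Proof. by move=> a; apply: linAutP => x; apply: linAut_funK. Qed.
Fact linAut_mulV : right_inverse linAut_one linAut_inv linAut_mul.
Proof. by move=> a; apply: linAutP => x; apply: linAut_inv_funK. Qed.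
HB.instance Definition _ := isGroup.Build linAut
  linAut_mulA linAut_1mul linAut_mul1 linAut_Vmul linAut_mulV.

End LinearAutomorphisms.

(* [Quat a b c d] is a + b e1 + c e2 + d e3, where e1 e2 = e3. *)
Record quat (T : Type) := Quat { q0 : T; q1 : T; q2 : T; q3 : T }.

Definition quat_to_tuple T (x : quat T) :=
  let: Quat a b c d := x in (a, b, c, d).
Definition quat_of_tuple T (x : T * T * T * T) :=
  let: (a, b, c, d) := x in Quat a b c d.
Fact quat_tupleK T : cancel (@quat_to_tuple T) (@quat_of_tuple T).
Proof. by case. Qed.
HB.instance Definition _ (T : choiceType) :=
  Choice.copy (quat T) (can_type (@quat_tupleK T)).

Section Quaternions.
Variable R : comNzRingType.
Implicit Types x y : quat R.

Definition addq x y :=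
  Quat (q0 x + q0 y) (q1 x + q1 y) (q2 x + q2 y) (q3 x + q3 y).
Definition oppq x := Quat (- q0 x) (- q1 x) (- q2 x) (- q3 x).
Definition zeroq : quat R := Quat 0 0 0 0.
Definition oneq : quat R := Quat 1 0 0 0.
Definition scaleq (k : R) x := Quat (k * q0 x) (k * q1 x) (k * q2 x) (k * q3 x).
Definition mulq x y :=
  Quat (q0 x * q0 y - q1 x * q1 y - q2 x * q2 y - q3 x * q3 y)
       (q0 x * q1 y + q1 x * q0 y + q2 x * q3 y - q3 x * q2 y)
       (q0 x * q2 y - q1 x * q3 y + q2 x * q0 y + q3 x * q1 y)
       (q0 x * q3 y + q1 x * q2 y - q2 x * q1 y + q3 x * q0 y).
Definition conjq x := Quat (q0 x) (- q1 x) (- q2 x) (- q3 x).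

Fact addqA : associative addq.
Proof. by case=> ???? [????] [????]; congr Quat => /=; ring. Qed.
Fact addqC : commutative addq.
Proof. by case=> ???? [????]; congr Quat => /=; ring. Qed.
Fact add0q : left_id zeroq addq.
Proof. by case=> ????; congr Quat => /=; ring. Qed.
Fact addNq : left_inverse zeroq oppq addq.
Proof. by case=> ????; congr Quat => /=; ring. Qed.
HB.instance Definition _ :=
  GRing.isZmodule.Build (quat R) addqA addqC add0q addNq.

Fact mulqA : associative mulq.
Proof. by case=> ???? [????] [????]; congr Quat => /=; ring. Qed.
Fact mul1q : left_id oneq mulq.
Proof. by case=> ????; congr Quat => /=; ring. Qed.
Fact mulq1 : right_id oneq mulq.
Proof. by case=> ????; congr Quat => /=; ring. Qed.
Fact mulqDl : left_distributive mulq addq.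
Proof. by case=> ???? [????] [????]; congr Quat => /=; ring. Qed.
Fact mulqDr : right_distributive mulq addq.
Proof. by case=> ???? [????] [????]; congr Quat => /=; ring. Qed.
Fact oneq_neq0 : oneq != 0.
Proof. by apply/eqP => -[/eqP]; rewrite oner_eq0. Qed.
HB.instance Definition _ := GRing.Zmodule_isNzRing.Build (quat R)
  mulqA mul1q mulq1 mulqDl mulqDr oneq_neq0.

Fact scaleqA (a b : R) x : scaleq a (scaleq b x) = scaleq (a * b) x.
Proof. by case: x => ????; congr Quat => /=; ring. Qed.
Fact scale1q : left_id 1 scaleq.
Proof. by case=> ????; congr Quat => /=; ring. Qed.
Fact scaleqDr : right_distributive scaleq +%R.
Proof. by move=> a [????] [????]; congr Quat => /=; ring. Qed.
Fact scaleqDl x : {morph scaleq^~ x : a b / a + b}.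
Proof. by case: x => ???? a b; congr Quat => /=; ring. Qed.
HB.instance Definition _ := GRing.Zmodule_isLmodule.Build R (quat R)
  scaleqA scale1q scaleqDr scaleqDl.

Lemma addqE x y : x + y = addq x y. Proof. by []. Qed.
Lemma oppqE x : - x = oppq x. Proof. by []. Qed.
Lemma mulqE x y : x * y = mulq x y. Proof. by []. Qed.
Lemma scaleqE (k : R) x : k *: x = scaleq k x. Proof. by []. Qed.
Lemma zeroqE : 0 = zeroq. Proof. by []. Qed.

End Quaternions.

(* [Cayley m n] is m + n e4. *)
Record cayley (T : Type) := Cayley { cfst : quat T; csnd : quat T }.

Definition cayley_to_pair T (x : cayley T) := (cfst x, csnd x).
Definition cayley_of_pair T (x : quat T * quat T) := Cayley x.1 x.2.
Fact cayley_pairK T : cancel (@cayley_to_pair T) (@cayley_of_pair T).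
Proof. by case. Qed.
HB.instance Definition _ (T : choiceType) :=
  Choice.copy (cayley T) (can_type (@cayley_pairK T)).

Section Cayley.
Variable R : comNzRingType.
Implicit Types x y : cayley R.

Definition cadd x y := Cayley (cfst x + cfst y) (csnd x + csnd y).
Definition copp x := Cayley (- cfst x) (- csnd x).
Definition czero : cayley R := Cayley 0 0.
Definition cscale (k : R) x := Cayley (k *: cfst x) (k *: csnd x).

Fact caddA : associative cadd.
Proof. by move=> x y z; congr Cayley; apply: addrA. Qed.
Fact caddC : commutative cadd.
Proof. by move=> x y; congr Cayley; apply: addrC. Qed.
Fact cadd0 : left_id czero cadd.
Proof. by case=> m n; congr Cayley; apply: add0r. Qed.
Fact caddN : left_inverse czero copp cadd.
Proof. by move=> x; congr Cayley; apply: addNr. Qed.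
HB.instance Definition _ :=
  GRing.isZmodule.Build (cayley R) caddA caddC cadd0 caddN.

Fact cscaleA (a b : R) x : cscale a (cscale b x) = cscale (a * b) x.
Proof. by congr Cayley; apply: scalerA. Qed.
Fact cscale1 : left_id 1 cscale.
Proof. by case=> m n; congr Cayley; apply: scale1r. Qed.
Fact cscaleDr : right_distributive cscale +%R.
Proof. by move=> a x y; congr Cayley; apply: scalerDr. Qed.
Fact cscaleDl x : {morph cscale^~ x : a b / a + b}.
Proof. by move=> a b; congr Cayley; apply: scalerDl. Qed.
HB.instance Definition _ := GRing.Zmodule_isLmodule.Build R (cayley R)
  cscaleA cscale1 cscaleDr cscaleDl.

Definition cmul x y :=
  Cayley (cfst x * cfst y - conjq (csnd y) * csnd x)
         (csnd x * conjq (cfst y) + csnd y * cfst x).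
Definition cconj x := Cayley (conjq (cfst x)) (- csnd x).
(* The Euclidean inner product, for which 1, e1, ..., e7 are orthonormal. *)
Definition cdot x y : R :=
  q0 (cfst x) * q0 (cfst y) + q1 (cfst x) * q1 (cfst y) +
  q2 (cfst x) * q2 (cfst y) + q3 (cfst x) * q3 (cfst y) +
  q0 (csnd x) * q0 (csnd y) + q1 (csnd x) * q1 (csnd y) +
  q2 (csnd x) * q2 (csnd y) + q3 (csnd x) * q3 (csnd y).
Definition creal (r : R) := Cayley (Quat r 0 0 0) 0.
(* x + y 'i of R[i] is identified with x + y e1. *)
Definition ccomplex (z : R[i]) : cayley R :=
  Cayley (Quat (complex.Re z) (complex.Im z) 0 0) 0.

Lemma caddE x y :
  x + y = Cayley (addq (cfst x) (cfst y)) (addq (csnd x) (csnd y)).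
Proof. by []. Qed.
Lemma coppE x : - x = Cayley (oppq (cfst x)) (oppq (csnd x)).
Proof. by []. Qed.
Lemma cscaleE (k : R) x :
  k *: x = Cayley (scaleq k (cfst x)) (scaleq k (csnd x)).
Proof. by []. Qed.
Lemma czeroE : 0 = Cayley (zeroq R) (zeroq R). Proof. by []. Qed.
Definition cE := (caddE, coppE, cscaleE, czeroE,
  @addqE R, @oppqE R, @mulqE R, @scaleqE R, @zeroqE R).

Lemma cayley_eq x y :
  q0 (cfst x) = q0 (cfst y) -> q1 (cfst x) = q1 (cfst y) ->
  q2 (cfst x) = q2 (cfst y) -> q3 (cfst x) = q3 (cfst y) ->
  q0 (csnd x) = q0 (csnd y) -> q1 (csnd x) = q1 (csnd y) ->
  q2 (csnd x) = q2 (csnd y) -> q3 (csnd x) = q3 (csnd y) -> x = y.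
Proof.
case: x y => [[????] [????]] [[????] [????]] /=.
by do 8![move=> ->].
Qed.

Lemma cconjK : involutive cconj.
Proof. by move=> x; apply: cayley_eq; rewrite /cconj /= ?cE /=; ring. Qed.

Lemma cconj_linear : linear cconj.
Proof. by move=> k x y; apply: cayley_eq; rewrite /cconj /= ?cE /=; ring. Qed.
HB.instance Definition _ :=
  GRing.isLinear.Build R (cayley R) (cayley R) *:%R cconj cconj_linear.

Lemma cconj_mul x y : cconj (cmul x y) = cmul (cconj y) (cconj x).
Proof.
by apply: cayley_eq; rewrite /cconj /cmul /= ?cE /=; ring.
Qed.

Lemma cmul_linear x : linear (cmul x).
Proof. by move=> k y z; apply: cayley_eq; rewrite /cmul /= ?cE /=; ring. Qed.
Lemma cmulr_linear x : linear (cmul^~ x).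
Proof. by move=> k y z; apply: cayley_eq; rewrite /cmul /= ?cE /=; ring. Qed.

End Cayley.

Section Jordan.
Variable R : realType.
Local Notation O := (cayley R).
Implicit Types (M N : 'M[O]_3).

Definition cmulmx M N : 'M[O]_3 := \matrix_(i, j) \sum_k cmul (M i k) (N k j).
Definition cadjmx M : 'M[O]_3 := map_mx (@cconj R) M^T.
Definition chermmx : pred 'M[O]_3 := fun M => cadjmx M == M.

Lemma chermmxP M :
  reflect (forall i j, M i j = cconj (M j i)) (chermmx M).
Proof.
apply: (iffP eqP) => [e i j|e]; first by rewrite -{1}e !mxE.
by apply/matrixP => i j; rewrite !mxE -e.
Qed.

Definition jordan := {M : 'M[O]_3 | chermmx M}.
HB.instance Definition _ := SubChoice.on jordan.

Fact chermmx_closed : zmod_closed chermmx.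
Proof.
split=> [|M N /chermmxP hM /chermmxP hN]; apply/chermmxP => i j.
  by rewrite !mxE linear0.
by rewrite !mxE linearB /= -hM -hN.
Qed.
HB.instance Definition _ :=
  GRing.SubChoice_isSubZmodule.Build 'M[O]_3 chermmx jordan chermmx_closed.

Definition cscalemx (k : R) M : 'M[O]_3 := map_mx ( *:%R k) M.
Fact cscalemx_herm (k : R) (X : jordan) : chermmx (cscalemx k (val X)).
Proof.
apply/chermmxP => i j; rewrite !mxE linearZ /=.
by rewrite -(chermmxP _ (valP X)).
Qed.
Definition jscale (k : R) (X : jordan) : jordan := Sub _ (cscalemx_herm k X).

Fact jscaleA (a b : R) X : jscale a (jscale b X) = jscale (a * b) X.
Proof. by apply/val_inj/matrixP => i j; rewrite !mxE scalerA. Qed.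
Fact jscale1 : left_id 1 jscale.
Proof. by move=> X; apply/val_inj/matrixP => i j; rewrite !mxE scale1r. Qed.
Fact jscaleDr : right_distributive jscale +%R.
Proof. by move=> a X Y; apply/val_inj/matrixP => i j; rewrite !mxE scalerDr. Qed.
Fact jscaleDl X : {morph jscale^~ X : a b / a + b}.
Proof. by move=> a b; apply/val_inj/matrixP => i j; rewrite !mxE scalerDl. Qed.
HB.instance Definition _ := GRing.Zmodule_isLmodule.Build R jordan
  jscaleA jscale1 jscaleDr jscaleDl.

Definition jmulmx M N := cscalemx 2^-1 (cmulmx M N + cmulmx N M).

Fact jmulmx_herm (X Y : jordan) : chermmx (jmulmx (val X) (val Y)).
Proof.
have hX := chermmxP _ (valP X); have hY := chermmxP _ (valP Y).
apply/chermmxP => i j; rewrite !mxE [RHS]linearZ /=.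
congr (_ *: _); rewrite linearD addrC !linear_sum /=.
by congr (_ + _); apply: eq_bigr => k _; rewrite cconj_mul -hX -hY.
Qed.
Definition jmul (X Y : jordan) : jordan := Sub _ (jmulmx_herm X Y).

End Jordan.

Section JordanCoordinates.
Variable R : realType.
Local Notation O := (cayley R).
Implicit Types (a b : R) (x y : O) (X Y : jordan R).

Definition jmx_mx a1 a2 a3 x1 x2 x3 : 'M[O]_3 :=
  \matrix_(i, j) nth 0 (nth [::]
    [:: [:: creal a1; x3;       cconj x2];
        [:: cconj x3; creal a2; x1      ];
        [:: x2;       cconj x1; creal a3]] i) j.

Fact creal_conj a : cconj (creal a) = creal a.
Proof. by apply: cayley_eq; rewrite /= ?cE /= ?oppr0. Qed.

Fact jmx_herm a1 a2 a3 x1 x2 x3 : chermmx (jmx_mx a1 a2 a3 x1 x2 x3).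
Proof.
by apply/chermmxP => -[[|[|[|//]]] ?] [[|[|[|//]]] ?];
  rewrite !mxE /= ?creal_conj ?cconjK.
Qed.
Definition jmx a1 a2 a3 x1 x2 x3 : jordan R := Sub _ (jmx_herm a1 a2 a3 x1 x2 x3).

Definition jxi1 X : R := q0 (cfst (val X 0 0)).
Definition jxi2 X : R := q0 (cfst (val X 1 1)).
Definition jxi3 X : R := q0 (cfst (val X 2 2)).
Definition jx1 X : O := val X 1 2.
Definition jx2 X : O := val X 2 0.
Definition jx3 X : O := val X 0 1.

Lemma jmxE a1 a2 a3 x1 x2 x3 (X := jmx a1 a2 a3 x1 x2 x3) :
  (jxi1 X = a1) * (jxi2 X = a2) * (jxi3 X = a3) *
  (jx1 X = x1) * (jx2 X = x2) * (jx3 X = x3).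
Proof. by rewrite /jxi1 /jxi2 /jxi3 /jx1 /jx2 /jx3 !mxE /=. Qed.

Fact cconj_fixed x : x = cconj x -> x = creal (q0 (cfst x)).
Proof.
have oppr_fix (r : R) : r = - r -> r = 0.
  by move/eqP; rewrite -subr_eq0 opprK -mulr2n mulrn_eq0 => /eqP.
case: x => [[a b c d] [e f g h]].
rewrite /cconj /= ?cE /oppq /= => -[hb hc hd he hf hg hh].
by congr Cayley; congr Quat; apply: oppr_fix.
Qed.

Lemma jmxK X : jmx (jxi1 X) (jxi2 X) (jxi3 X) (jx1 X) (jx2 X) (jx3 X) = X.
Proof.
have hX := chermmxP _ (valP X).
apply/val_inj/matrixP => -[[|[|[|//]]] ?] [[|[|[|//]]] ?];
  rewrite mxE /= ?[cconj _]hX /jxi1 /jxi2 /jxi3 /jx1 /jx2 /jx3 -?hX.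
all: try by rewrite -?cconj_fixed //; congr (sval X _ _); apply/val_inj.
Qed.

Lemma jordan_eq X Y :
  jxi1 X = jxi1 Y -> jxi2 X = jxi2 Y -> jxi3 X = jxi3 Y ->
  jx1 X = jx1 Y -> jx2 X = jx2 Y -> jx3 X = jx3 Y -> X = Y.
Proof. by move=> *; rewrite -[X]jmxK -[Y]jmxK; congr jmx. Qed.

Lemma jlinE (k : R) X Y :
  (jxi1 (k *: X + Y) = k * jxi1 X + jxi1 Y) *
  (jxi2 (k *: X + Y) = k * jxi2 X + jxi2 Y) *
  (jxi3 (k *: X + Y) = k * jxi3 X + jxi3 Y) *
  (jx1 (k *: X + Y) = k *: jx1 X + jx1 Y) *
  (jx2 (k *: X + Y) = k *: jx2 X + jx2 Y) *
  (jx3 (k *: X + Y) = k *: jx3 X + jx3 Y).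
Proof. by rewrite /jxi1 /jxi2 /jxi3 /jx1 /jx2 /jx3 !mxE /=. Qed.

Lemma jmulE a1 a2 a3 x1 x2 x3 b1 b2 b3 y1 y2 y3 :
  jmul (jmx a1 a2 a3 x1 x2 x3) (jmx b1 b2 b3 y1 y2 y3) =
  jmx (a1 * b1 + cdot x2 y2 + cdot x3 y3)
      (a2 * b2 + cdot x3 y3 + cdot x1 y1)
      (a3 * b3 + cdot x1 y1 + cdot x2 y2)
      (2^-1 *: ((a2 + a3) *: y1 + (b2 + b3) *: x1 +
                cconj (cmul x2 y3) + cconj (cmul y2 x3)))
      (2^-1 *: ((a3 + a1) *: y2 + (b3 + b1) *: x2 +
                cconj (cmul x3 y1) + cconj (cmul y3 x1)))
      (2^-1 *: ((a1 + a2) *: y3 + (b1 + b2) *: x3 +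
                cconj (cmul x1 y2) + cconj (cmul y1 x2))).
Proof.
apply: jordan_eq; rewrite !jmxE;
  rewrite /jxi1 /jxi2 /jxi3 /jx1 /jx2 /jx3 /= !mxE !big_ord_recl !big_ord0;
  rewrite !mxE /=.
1-3: by rewrite ?cE /= /cdot; field.
all: by apply: cayley_eq; rewrite ?cE /=; field.
Qed.

Section Action.
Variables f1 f2 f3 : O -> O.

Definition jact X : jordan R :=
  jmx (jxi1 X) (jxi2 X) (jxi3 X) (f1 (jx1 X)) (f2 (jx2 X)) (f3 (jx3 X)).

Lemma jact_linear : linear f1 -> linear f2 -> linear f3 -> linear jact.
Proof.
move=> l1 l2 l3 k X Y.
by apply: jordan_eq; rewrite !(jmxE, jlinE) ?l1 ?l2 ?l3.
Qed.

Lemma jact_jmul :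
  linear f1 -> linear f2 -> linear f3 ->
  (forall x y, cdot (f1 x) (f1 y) = cdot x y) ->
  (forall x y, cdot (f2 x) (f2 y) = cdot x y) ->
  (forall x y, cdot (f3 x) (f3 y) = cdot x y) ->
  (forall x y, cconj (cmul (f2 x) (f3 y)) = f1 (cconj (cmul x y))) ->
  (forall x y, cconj (cmul (f3 x) (f1 y)) = f2 (cconj (cmul x y))) ->
  (forall x y, cconj (cmul (f1 x) (f2 y)) = f3 (cconj (cmul x y))) ->
  forall X Y, jact (jmul X Y) = jmul (jact X) (jact Y).
Proof.
move=> l1 l2 l3 d1 d2 d3 t1 t2 t3 X Y.
have lD f : linear f -> forall x y, f (x + y) = f x + f y :> O.
  by move=> l x y; rewrite -[x]scale1r l !scale1r.
have lZ f : linear f -> forall k x, f (k *: x) = k *: f x :> O.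
  move=> l k x; have l0 : f 0 = 0 by have := l (-1) 0 0; rewrite !scaleN1r addNr addNr.
  by rewrite -[k *: x]addr0 l l0 !addr0.
rewrite -[X]jmxK -[Y]jmxK /jact jmulE !jmxE jmulE.
congr jmx; rewrite ?d1 ?d2 ?d3 //.
- by rewrite (lZ _ l1) 3!(lD _ l1) 2!(lZ _ l1) 2!t1.
- by rewrite (lZ _ l2) 3!(lD _ l2) 2!(lZ _ l2) 2!t2.
- by rewrite (lZ _ l3) 3!(lD _ l3) 2!(lZ _ l3) 2!t3.
Qed.

End Action.

Lemma jactK f1 f2 f3 g1 g2 g3 : cancel f1 g1 -> cancel f2 g2 -> cancel f3 g3 ->
  cancel (jact f1 f2 f3) (jact g1 g2 g3).
Proof.
by move=> k1 k2 k3 X; apply: jordan_eq; rewrite !jmxE ?k1 ?k2 ?k3.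
Qed.

End JordanCoordinates.

Section F4.
Variable R : realType.
Local Notation O := (cayley R).

Definition F4_pred : {pred linAut (jordan R)} :=
  fun a => `[< forall X Y, a (jmul X Y) = jmul (a X) (a Y) >].

Fact F4M : mulg_closed F4_pred.
Proof.
by move=> a b /asboolP aP /asboolP bP; apply/asboolP => X Y /=; rewrite bP aP.
Qed.
Fact F41 : 1%g \in F4_pred.
Proof. exact/asboolP. Qed.
Fact F4V : invg_closed F4_pred.
Proof.
move=> a /asboolP aP; apply/asboolP => X Y /=.
by apply: (can_inj (linAut_funK a)); rewrite aP !linAut_inv_funK.
Qed.
HB.instance Definition _ := isMulClosed.Build (linAut (jordan R)) F4_pred F4M.
HB.instance Definition _ := isMul1Closed.Build (linAut (jordan R)) F4_pred F41.
HB.instance Definition _ := isInvClosed.Build (linAut (jordan R)) F4_pred F4V.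

Definition F4 := subgrp F4_pred.
HB.instance Definition _ := Group.on F4.

Definition omega : R[i] := Complex (- 2^-1) (Num.sqrt 3 / 2).
Local Notation w := (ccomplex omega).
Local Notation wbar := (ccomplex (conjc omega)).

(* The bracketing in [sigma3_x1] is immaterial, see [ccomplexAC] below. *)
Definition sigma3_x1 (x : O) := cmul (cmul wbar x) wbar.
Definition sigma3_x2 (x : O) := cmul w x.
Definition sigma3_x3 (x : O) := cmul x w.
Definition sigma3_fun := jact sigma3_x1 sigma3_x2 sigma3_x3.

(* The orthogonal projection of the Cayley algebra onto R + R e1. *)
Definition cproj (x : O) : R[i] := Complex (q0 (cfst x)) (q1 (cfst x)).
Definition w3_cayley (x : O) : O :=
  ccomplex (cproj x) + cmul w (x - ccomplex (cproj x)).
Definition w3_fun := jact w3_cayley w3_cayley w3_cayley.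

(* The action of w_3 on m0 + m1 e2 + m2 e4 + m3 e6, with e6 = e2 e4. *)
Lemma w3_cayleyE (m0 m1 m2 m3 : R[i])
    (e2 := Cayley (Quat 0 0 1 0) 0) (e4 := Cayley 0 (Quat 1 0 0 0)) :
  w3_cayley (ccomplex m0 + cmul (ccomplex m1) e2 + cmul (ccomplex m2) e4 +
             cmul (ccomplex m3) (cmul e2 e4)) =
  ccomplex m0 + cmul (ccomplex (omega * m1)) e2 +
  cmul (ccomplex (omega * m2)) e4 +
  cmul (ccomplex (omega * m3)) (cmul e2 e4).
Proof.
by case: m0 m1 m2 m3 => [? ?] [? ?] [? ?] [? ?];
  apply: cayley_eq; rewrite /w3_cayley ?cE /=; ring.
Qed.

Fact omega_sqr : (Num.sqrt 3 : R) ^+ 2 = 3.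
Proof. by rewrite sqr_sqrtr// ler0n. Qed.

Fact omega_conj : (omega : R[i]) * conjc omega = 1 :> R[i].
Proof.
by apply/eqP; rewrite eq_complex /=; apply/andP; split; apply/eqP;
  field: omega_sqr.
Qed.

Fact ccomplexA (y z : R[i]) x :
  cmul (ccomplex y) (cmul (ccomplex z) x) = cmul (ccomplex (y * z)) x.
Proof. by case: y z => [? ?] [? ?]; apply: cayley_eq; rewrite ?cE /=; ring. Qed.
Fact ccomplexAr (y z : R[i]) x :
  cmul (cmul x (ccomplex y)) (ccomplex z) = cmul x (ccomplex (y * z)).
Proof. by case: y z => [? ?] [? ?]; apply: cayley_eq; rewrite ?cE /=; ring. Qed.
Fact ccomplexAC (y : R[i]) x :
  cmul (cmul (ccomplex y) x) (ccomplex y) =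
  cmul (ccomplex y) (cmul x (ccomplex y)).
Proof. by case: y => [? ?]; apply: cayley_eq; rewrite ?cE /=; ring. Qed.
Fact ccomplex1 (x : O) : cmul (ccomplex (1 : R[i])) x = x.
Proof. by apply: cayley_eq; rewrite ?cE /=; ring. Qed.
Fact ccomplex1r (x : O) : cmul x (ccomplex (1 : R[i])) = x.
Proof. by apply: cayley_eq; rewrite ?cE /=; ring. Qed.

Fact sigma3_x1_linear : linear sigma3_x1.
Proof. by move=> k x y; rewrite /sigma3_x1 cmul_linear cmulr_linear. Qed.
Fact sigma3_x2_linear : linear sigma3_x2.
Proof. exact: cmul_linear. Qed.
Fact sigma3_x3_linear : linear sigma3_x3.
Proof. exact: cmulr_linear. Qed.
Fact w3_linear : linear w3_cayley.
Proof.
by move=> k x y; apply: cayley_eq; rewrite /w3_cayley ?cE /=; ring.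
Qed.

Fact sigma3_x1K : cancel sigma3_x1 (fun x => cmul (cmul w x) w).
Proof.
move=> x; rewrite /sigma3_x1 (ccomplexAC _ x) ccomplexA omega_conj ccomplex1.
by rewrite ccomplexAr mulrC omega_conj ccomplex1r.
Qed.
Fact sigma3_x1VK : cancel (fun x => cmul (cmul w x) w) sigma3_x1.
Proof.
move=> x; rewrite /sigma3_x1 (ccomplexAC _ x) ccomplexA mulrC omega_conj.
by rewrite ccomplex1 ccomplexAr omega_conj ccomplex1r.
Qed.
Fact sigma3_x2K : cancel sigma3_x2 (cmul wbar).
Proof. by move=> x; rewrite ccomplexA mulrC omega_conj ccomplex1. Qed.
Fact sigma3_x2VK : cancel (cmul wbar) sigma3_x2.
Proof. by move=> x; rewrite /sigma3_x2 ccomplexA omega_conj ccomplex1. Qed.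
Fact sigma3_x3K : cancel sigma3_x3 (fun x => cmul x wbar).
Proof. by move=> x; rewrite /sigma3_x3 ccomplexAr omega_conj ccomplex1r. Qed.
Fact sigma3_x3VK : cancel (fun x => cmul x wbar) sigma3_x3.
Proof. by move=> x; rewrite /sigma3_x3 ccomplexAr mulrC omega_conj ccomplex1r. Qed.

Definition w3_cayley_inv (x : O) : O :=
  ccomplex (cproj x) + cmul wbar (x - ccomplex (cproj x)).
Fact w3_cayleyK : cancel w3_cayley w3_cayley_inv.
Proof.
move=> x; apply: cayley_eq; rewrite /w3_cayley /w3_cayley_inv /omega ?cE /=;
  by field: omega_sqr.
Qed.
Fact w3_cayleyVK : cancel w3_cayley_inv w3_cayley.
Proof.
move=> x; apply: cayley_eq; rewrite /w3_cayley /w3_cayley_inv /omega ?cE /=;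
  by field: omega_sqr.
Qed.

Fact omega_norm : complex.Im omega ^+ 2 = 1 - complex.Re omega ^+ 2.
Proof. by rewrite /=; field: omega_sqr. Qed.

Fact sigma3_x1_dot x y : cdot (sigma3_x1 x) (sigma3_x1 y) = cdot x y.
Proof.
rewrite /sigma3_x1; case: omega omega_norm => a b /= ab.
by rewrite /cdot ?cE /=; ring: ab.
Qed.
Fact sigma3_x2_dot x y : cdot (sigma3_x2 x) (sigma3_x2 y) = cdot x y.
Proof.
rewrite /sigma3_x2; case: omega omega_norm => a b /= ab.
by rewrite /cdot ?cE /=; ring: ab.
Qed.
Fact sigma3_x3_dot x y : cdot (sigma3_x3 x) (sigma3_x3 y) = cdot x y.
Proof.
rewrite /sigma3_x3; case: omega omega_norm => a b /= ab.
by rewrite /cdot ?cE /=; ring: ab.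
Qed.
Fact w3_dot x y : cdot (w3_cayley x) (w3_cayley y) = cdot x y.
Proof.
rewrite /w3_cayley; case: omega omega_norm => a b /= ab.
by rewrite /cdot ?cE /=; ring: ab.
Qed.

Fact sigma3_tri1 x y :
  cconj (cmul (sigma3_x2 x) (sigma3_x3 y)) = sigma3_x1 (cconj (cmul x y)).
Proof.
rewrite /sigma3_x1 /sigma3_x2 /sigma3_x3; case: omega omega_norm => a b /= ab.
by apply: cayley_eq; rewrite ?cE /=; ring: ab.
Qed.
Fact sigma3_tri2 x y :
  cconj (cmul (sigma3_x3 x) (sigma3_x1 y)) = sigma3_x2 (cconj (cmul x y)).
Proof.
rewrite /sigma3_x1 /sigma3_x2 /sigma3_x3; case: omega omega_norm => a b /= ab.
by apply: cayley_eq; rewrite ?cE /=; ring: ab.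
Qed.
Fact sigma3_tri3 x y :
  cconj (cmul (sigma3_x1 x) (sigma3_x2 y)) = sigma3_x3 (cconj (cmul x y)).
Proof.
rewrite /sigma3_x1 /sigma3_x2 /sigma3_x3; case: omega omega_norm => a b /= ab.
by apply: cayley_eq; rewrite ?cE /=; ring: ab.
Qed.

Fact w3_tri x y :
  cconj (cmul (w3_cayley x) (w3_cayley y)) = w3_cayley (cconj (cmul x y)).
Proof.
apply: cayley_eq; rewrite /w3_cayley /omega ?cE /=; by field: omega_sqr.
Qed.

Fact sigma3_bij : bijective sigma3_fun.
Proof.
exists (jact (fun x => cmul (cmul w x) w) (cmul wbar) (fun x => cmul x wbar)).
  exact: (jactK sigma3_x1K sigma3_x2K sigma3_x3K).
exact: (jactK sigma3_x1VK sigma3_x2VK sigma3_x3VK).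
Qed.
Definition sigma3_lin : linAut (jordan R) :=
  LinAut (jact_linear sigma3_x1_linear sigma3_x2_linear sigma3_x3_linear)
    sigma3_bij.
Fact sigma3_F4 : sigma3_lin \in F4_pred.
Proof.
apply/asboolP.
exact: (jact_jmul sigma3_x1_linear sigma3_x2_linear sigma3_x3_linear
  sigma3_x1_dot sigma3_x2_dot sigma3_x3_dot sigma3_tri1 sigma3_tri2 sigma3_tri3).
Qed.
Definition sigma3 : F4 := Sub sigma3_lin sigma3_F4.

Fact w3_bij : bijective w3_fun.
Proof.
exists (jact w3_cayley_inv w3_cayley_inv w3_cayley_inv).
  exact: (jactK w3_cayleyK w3_cayleyK w3_cayleyK).
exact: (jactK w3_cayleyVK w3_cayleyVK w3_cayleyVK).
Qed.
Definition w3_lin : linAut (jordan R) :=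
  LinAut (jact_linear w3_linear w3_linear w3_linear) w3_bij.
Fact w3_F4 : w3_lin \in F4_pred.
Proof.
apply/asboolP.
exact: (jact_jmul w3_linear w3_linear w3_linear w3_dot w3_dot w3_dot
  w3_tri w3_tri w3_tri).
Qed.
Definition w3 : F4 := Sub w3_lin w3_F4.

End F4.

Section SpecialUnitary.
Variables (C : numClosedFieldType) (n : nat).

Definition SU_pred : pred 'M[C]_n :=
  fun A => (A \is spectral.unitarymx) && (\det A == 1).
Definition SU := {A : 'M[C]_n | SU_pred A}.
HB.instance Definition _ := SubChoice.on SU.

Fact SU_mulP (A B : SU) : SU_pred (val A *m val B).
Proof.
have /andP[uA /eqP dA] := valP A; have /andP[uB /eqP dB] := valP B.
by rewrite /SU_pred spectral.mul_unitarymx//= det_mulmx dA dB mulr1.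
Qed.
Fact SU_oneP : SU_pred 1%:M.
Proof.
by rewrite /SU_pred det1 eqxx andbT; apply/spectral.unitarymxP; rewrite trmx1 map_mx1 mulmx1.
Qed.
Fact SU_invP (A : SU) : SU_pred (invmx (val A)).
Proof.
have /andP[uA /eqP dA] := valP A.
rewrite /SU_pred det_inv dA invr1 eqxx andbT spectral.invmx_unitary//.
by rewrite spectral.trmxC_unitary.
Qed.
Definition SU_mul (A B : SU) : SU := Sub _ (SU_mulP A B).
Definition SU_one : SU := Sub _ SU_oneP.
Definition SU_inv (A : SU) : SU := Sub _ (SU_invP A).

Fact SU_unit (A : SU) : val A \in unitmx.
Proof. by have /andP[/spectral.unitarymx_unit] := valP A. Qed.
Fact SU_mulA : associative SU_mul.
Proof. by move=> A B D; apply/val_inj/mulmxA. Qed.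
Fact SU_1mul : left_id SU_one SU_mul.
Proof. by move=> A; apply/val_inj/mul1mx. Qed.
Fact SU_mul1 : right_id SU_one SU_mul.
Proof. by move=> A; apply/val_inj/mulmx1. Qed.
Fact SU_Vmul : left_inverse SU_one SU_inv SU_mul.
Proof. by move=> A; apply/val_inj/mulVmx/SU_unit. Qed.
Fact SU_mulV : right_inverse SU_one SU_inv SU_mul.
Proof. by move=> A; apply/val_inj/mulmxV/SU_unit. Qed.
HB.instance Definition _ :=
  isGroup.Build SU SU_mulA SU_1mul SU_mul1 SU_Vmul SU_mulV.

End SpecialUnitary.

Section UnitCircle.
Variable C : numClosedFieldType.

Definition U1_pred : pred C := fun z => `|z| == 1.
Definition U1 := {z : C | U1_pred z}.
HB.instance Definition _ := SubChoice.on U1.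

Fact U1_mulP (y z : U1) : U1_pred (val y * val z).
Proof. by rewrite /U1_pred normrM (eqP (valP y)) (eqP (valP z)) mulr1. Qed.
Fact U1_oneP : U1_pred (1 : C). Proof. by rewrite /U1_pred normr1. Qed.
Fact U1_invP (z : U1) : U1_pred ((val z)^-1).
Proof. by rewrite /U1_pred normfV (eqP (valP z)) invr1. Qed.
Definition U1_mul (y z : U1) : U1 := Sub _ (U1_mulP y z).
Definition U1_one : U1 := Sub _ U1_oneP.
Definition U1_inv (z : U1) : U1 := Sub _ (U1_invP z).

Fact U1_neq0 (z : U1) : val z != 0.
Proof. by rewrite -normr_gt0 (eqP (valP z)). Qed.
Fact U1_mulA : associative U1_mul.
Proof. by move=> x y z; apply/val_inj/mulrA. Qed.
Fact U1_1mul : left_id U1_one U1_mul.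
Proof. by move=> x; apply/val_inj/mul1r. Qed.
Fact U1_mul1 : right_id U1_one U1_mul.
Proof. by move=> x; apply/val_inj/mulr1. Qed.
Fact U1_Vmul : left_inverse U1_one U1_inv U1_mul.
Proof. by move=> x; apply/val_inj/mulVf/U1_neq0. Qed.
Fact U1_mulV : right_inverse U1_one U1_inv U1_mul.
Proof. by move=> x; apply/val_inj/mulfV/U1_neq0. Qed.
HB.instance Definition _ :=
  isGroup.Build U1 U1_mulA U1_1mul U1_mul1 U1_Vmul U1_mulV.

End UnitCircle.

Section Z3.
Variable R : realType.
Local Notation w := (omega R).
Local Notation K := (SU R[i] 3 * U1 R[i] * U1 R[i])%type.

Definition Z3 : {pred K} := fun g =>
  (val g.1.1, val g.1.2, val g.2) \in
  [:: (1%:M, 1, 1); (w%:M, w, w); (w^-1%:M, w^-1, w^-1)].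

Fact omega_neq0 : w != 0.
Proof.
by apply/eqP => e; have /eqP := omega_conj R; rewrite e mul0r eq_sym oner_eq0.
Qed.
Fact omega_inv : w^-1 = conjc w.
Proof.
by apply: (mulfI omega_neq0); rewrite mulfV ?omega_neq0// omega_conj.
Qed.
Fact omega_mul : w * w = w^-1.
Proof.
by rewrite omega_inv; apply/eqP; rewrite eq_complex /=; apply/andP; split;
  apply/eqP; field: (omega_sqr R).
Qed.
Fact Z3P (g : K) :
  reflect (exists2 z, z \in [:: 1; w; w^-1] &
            (val g.1.1, val g.1.2, val g.2) = (z%:M, z, z)) (g \in Z3).
Proof.
rewrite unfold_in; apply: (iffP idP) => [|[z + ->]].
  rewrite !inE => /or3P[] /eqP ->; [exists 1|exists w|exists w^-1];
    by rewrite // !inE eqxx ?orbT.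
by rewrite !inE => /or3P[] /eqP ->; rewrite eqxx ?orbT.
Qed.

Fact cube_rootsM y z : y \in [:: 1; w; w^-1] -> z \in [:: 1; w; w^-1] ->
  y * z \in [:: 1; w; w^-1].
Proof.
have wV2 : w^-1 * w^-1 = w by rewrite -omega_mul -mulrA omega_mul mulfV ?mulr1// omega_neq0.
rewrite !inE => /or3P[] /eqP -> /or3P[] /eqP ->;
  by rewrite ?mul1r ?mulr1 ?omega_mul ?wV2 ?mulfV ?mulVf ?omega_neq0 // eqxx ?orbT.
Qed.

Fact Z3M : mulg_closed Z3.
Proof.
move=> g h /Z3P[y y3 [gA ga gb]] /Z3P[z z3 [hA ha hb]]; apply/Z3P.
exists (y * z); first exact: cube_rootsM.
by rewrite /= gA hA ga ha gb hb -scalar_mxM.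
Qed.
Fact Z31 : 1%g \in Z3.
Proof. by apply/Z3P; exists 1; rewrite ?mem_head. Qed.
Fact Z3V : invg_closed Z3.
Proof.
move=> g /Z3P[y y3 [gA ga gb]]; apply/Z3P; exists y^-1.
  move: y3; rewrite !inE => /or3P[] /eqP ->; by rewrite ?invr1 ?invrK eqxx ?orbT.
by rewrite /= gA ga gb invmx_scalar.
Qed.
Fact Z3J g h : g \in Z3 -> (g ^ h)%g \in Z3.
Proof.
move=> g3; suff -> : (g ^ h)%g = g by [].
suff gh : (g * h = h * g)%g by rewrite /conjg gh mulKg.
case/Z3P: g3 => y _ [gA ga gb]; case: g h gA ga gb => [[A a] b] [[B c] d] /= gA ga gb.
congr (_, _, _); apply/val_inj => /=.
- by rewrite gA scalar_mxC.
- by rewrite mulrC.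
- by rewrite mulrC.
Qed.
HB.instance Definition _ := isMulClosed.Build K Z3 Z3M.
HB.instance Definition _ := isMul1Closed.Build K Z3 Z31.
HB.instance Definition _ := isInvClosed.Build K Z3 Z3V.
HB.instance Definition _ := isNormalSub.Build K Z3 Z3J.

End Z3.
Arguments Z3 R _ : clear implicits.

(* Main.v *)
(* Split the Cayley algebra as C + C^3. An automorphism alpha commuting with
   sigma_3 and w_3 preserves their common eigenspaces: the diagonal matrices,
   and the C^3-part of each x_i. A diagonal idempotent is determined by which of
   the latter it annihilates, so alpha fixes E_1, E_2, E_3, and Peirce
   decomposition gives alpha = (alpha_1, alpha_2, alpha_3) acting on the x_i.
   Commutation with omega makes alpha_i complex linear on C and on C^3, say
   alpha_i (c + m) = a_i c + Q_i m. Triality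
   conj (alpha_2 x * alpha_3 y) = alpha_1 (conj (x y)) then reads
   a_1 = conj (a_2 a_3), Q_2 = a_3 Q_1, Q_3 = conj a_2 Q_1, with Q_1 unitary of
   determinant a_2 conj a_3. For b_1 a cube root of conj (det Q_1),
   b_2 = conj a_3 b_1, b_3 = a_2 b_1 and P = b_1 Q_1 one has
   det P = b_1 b_2 b_3 = 1, a_i = b_(i+1) conj b_(i+2) and Q_i = conj b_i P; the
   triple (P, b_1, b_2) is unique up to a common cube root of unity. *)

From HB Require Import structures.
Require Import Defs.
From mathcomp Require Import all_boot all_order all_algebra complex reals.
From mathcomp Require Import boolp ring.

Set Implicit Arguments.
Unset Strict Implicit.
Unset Printing Implicit Defensive.

Import Order.TTheory GRing.Theory Num.Theory.
Local Open Scope ring_scope.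

(** * The first isomorphism theorem *)

Section FirstIsomorphism.
Variables (K G : groupType) (N : normalClosed K) (f : K -> G).
Hypothesis fM : {morph f : x y / (x * y)%g}.
Hypothesis f_surj : forall y, exists x, f x = y.
Hypothesis f_ker : forall x, f x = 1%g -> x \in (N : {pred K}).
Hypothesis N_ker : forall x, x \in (N : {pred K}) -> f x = 1%g.

Let f1 : f 1%g = 1%g.
Proof. by apply: (mulgI (f 1%g)); rewrite -fM !mulg1. Qed.

Let fV x : f x^-1%g = (f x)^-1%g.
Proof. by apply: (mulgI (f x)); rewrite -fM !mulgV f1. Qed.

Local Open Scope quotient_scope.
(** The map runs from [G] to the quotient, as [isomorphic] demands. Choosing a preimage is harmless:
    two preimages differ by an element of the kernel. *)
Let lift y : quotg N := \pi_(quotg N) (sval (cid (f_surj y))).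

Let liftE x : lift (f x) = \pi_(quotg N) x.
Proof.
rewrite /lift; case: cid => z /= fz; apply/eqP; rewrite quotg_eqE.
by apply: f_ker; rewrite fM fV fz mulVg.
Qed.

Let liftM : {morph lift : x y / (x * y)%g}.
Proof.
move=> x y; have [u <-] := f_surj x; have [v <-] := f_surj y.
by rewrite -fM !liftE -quotg_mulE.
Qed.

HB.instance Definition _ := isMultiplicative.Build G (quotg N) lift liftM.

Lemma first_isomorphism : isomorphic G (quotg N).
Proof.
exists (lift : {multiplicative G -> quotg N}).
apply: (@Bijective _ _ _ (fun x : quotg N => f (repr x))) => [y|x] /=.
  have [u <-] := f_surj y; rewrite liftE.
  have /N_ker := repr_coset N u; rewrite fM fV => e.
  by apply: (mulgI (f (repr (\pi_(quotg N) u)))^-1%g); rewrite e mulVg.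
by rewrite liftE reprK.
Qed.
End FirstIsomorphism.

(** * The Cayley algebra as C + C^3 *)

Section Cross.
Variable C : comNzRingType.
Implicit Types (u v : 'cV[C]_3) (A : 'M[C]_3).

Definition cross u v : 'cV[C]_3 :=
  \col_(i < 3) nth 0 [:: u 1 0 * v 2 0 - u 2 0 * v 1 0;
                         u 2 0 * v 0 0 - u 0 0 * v 2 0;
                         u 0 0 * v 1 0 - u 1 0 * v 0 0] i.

Lemma ord3P (P : 'I_3 -> Prop) : P 0 -> P 1 -> P 2 -> forall i, P i.
Proof.
move=> P0 P1 P2 [[|[|[|//]]] i3].
- by have -> : Ordinal i3 = 0 by apply/val_inj.
- by have -> : Ordinal i3 = 1 by apply/val_inj.
- by have -> : Ordinal i3 = 2 by apply/val_inj.
Qed.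

Lemma sum3E (F : 'I_3 -> C) : \sum_i F i = F 0 + F 1 + F 2.
Proof.
rewrite !big_ord_recl big_ord0 addr0 addrA.
by congr (_ + F _ + F _); apply/val_inj.
Qed.

Lemma det2E (B : 'M[C]_2) : \det B = B 0 0 * B 1 1 - B 0 1 * B 1 0.
Proof.
rewrite (expand_det_row _ 0) !big_ord_recl big_ord0 addr0 /cofactor !det_mx11
  !mxE /=.
have -> : lift 0 0 = 1 :> 'I_2 by apply/val_inj.
have -> : lift 1 0 = 0 :> 'I_2 by apply/val_inj.
by rewrite /= expr0 expr1 mul1r mulN1r mulrN.
Qed.

(** The coordinates of a cross product are 2 x 2 minors, and on these [A] acts by its cofactor
    matrix. This is a polynomial identity, so [A] may be singular. *)
Lemma cross_mul A u v : cross (A *m u) (A *m v) = (\adj A)^T *m cross u v.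
Proof.
have liftE : (lift (0 : 'I_3) (0 : 'I_2) = 1) * (lift (0 : 'I_3) (1 : 'I_2) = 2)
  * (lift (1 : 'I_3) (0 : 'I_2) = 0) * (lift (1 : 'I_3) (1 : 'I_2) = 2)
  * (lift (2 : 'I_3) (0 : 'I_2) = 0) * (lift (2 : 'I_3) (1 : 'I_2) = 1).
  by do !split; apply/val_inj.
apply/matrixP; apply: ord3P => j; rewrite (ord1 j) !mxE !sum3E !mxE /= ?sum3E.
all: rewrite /cofactor !det2E !mxE !liftE /=; ring.
Qed.
End Cross.

Section Octonions.
Variable R : realType.
Local Notation C := R[i].
Local Notation O := (cayley R).
Implicit Types (p q a b z : C) (u v : 'cV[C]_3) (x y : O).

(* [oct p v] is p + v_0 e2 + v_1 e4 + v_2 e6 with e6 = e2 e4; the minus sign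
   comes from e1 (e2 e4) = (e2 e1) e4. *)
Definition oct p v : O :=
  Cayley (Quat (complex.Re p) (complex.Im p)
               (complex.Re (v 0 0)) (complex.Im (v 0 0)))
         (Quat (complex.Re (v 1 0)) (complex.Im (v 1 0))
               (complex.Re (v 2 0)) (- complex.Im (v 2 0))).
Definition cvec x : 'cV[C]_3 :=
  \col_(i < 3) nth 0 [:: Complex (q2 (cfst x)) (q3 (cfst x));
                         Complex (q0 (csnd x)) (q1 (csnd x));
                         Complex (q2 (csnd x)) (- q3 (csnd x))] i.
Definition herm u v : C := \sum_i u i 0 * (v i 0)^*.
Definition conjv v : 'cV[C]_3 := map_mx Num.conj v.

Lemma complexRe_inj z z' :
  complex.Re z = complex.Re z' -> complex.Im z = complex.Im z' -> z = z'.
Proof. by case: z z' => [? ?] [? ?] /= -> ->. Qed.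

Lemma octK x : oct (cproj x) (cvec x) = x.
Proof. by apply: cayley_eq; rewrite /= ?mxE //= opprK. Qed.

Lemma cproj_oct p v : cproj (oct p v) = p.
Proof. by case: p. Qed.

Lemma cvec_oct p v : cvec (oct p v) = v.
Proof.
apply/matrixP; apply: ord3P => j; rewrite (ord1 j) mxE /= ?opprK;
  by case: (v _ _).
Qed.

Lemma oct_inj p q u v : oct p u = oct q v -> p = q /\ u = v.
Proof.
move=> e; split; first by rewrite -(cproj_oct p u) e cproj_oct.
by rewrite -(cvec_oct p u) e cvec_oct.
Qed.

Lemma octD p q u v : oct p u + oct q v = oct (p + q) (u + v).
Proof.
case: p q => [? ?] [? ?].
apply: cayley_eq; rewrite ?cE /= ?mxE //.
all: by case: (u _ _) (v _ _) => [? ?] [? ?] //=; rewrite opprD.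
Qed.

Lemma octZ (k : R) p v : k *: oct p v = oct (k%:C%C * p) (k%:C%C *: v).
Proof.
case: p => [? ?].
apply: cayley_eq; rewrite ?cE /= ?mxE; try case: (v _ _) => ? ? /=; ring.
Qed.

(** All later computations with products go through this formula. A unitary matrix preserves [herm],
    so its determinant can enter only through the conjugated cross product. *)
Lemma cmul_oct p q u v :
  cmul (oct p u) (oct q v) =
  oct (p * q - herm u v) (p *: v + q^* *: u + conjv (cross u v)).
Proof.
rewrite /herm sum3E; case: p q => [? ?] [? ?].
apply: cayley_eq; rewrite ?cE /= ?mxE /=;
  case: (u 0 0) (u 1 0) (u 2 0) (v 0 0) (v 1 0) (v 2 0)
    => [? ?] [? ?] [? ?] [? ?] [? ?] [? ?] /=; ring.
Qed.

Lemma cconj_oct p v : cconj (oct p v) = oct p^* (- v).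
Proof.
case: p => [? ?]; apply: cayley_eq; rewrite ?cE /= ?mxE /=;
  try case: (v _ _) => ? ? //=; by rewrite ?opprK.
Qed.

Lemma cdot_oct p q u v :
  cdot (oct p u) (oct q v) = complex.Re (p * q^* + herm u v).
Proof.
rewrite /cdot /herm sum3E; case: p q => [? ?] [? ?] /=.
case: (u 0 0) (u 1 0) (u 2 0) (v 0 0) (v 1 0) (v 2 0)
  => [? ?] [? ?] [? ?] [? ?] [? ?] [? ?] /=; ring.
Qed.

Local Notation w := (omega R).

Lemma w3_oct p v : w3_cayley (oct p v) = oct p (w *: v).
Proof.
rewrite /w3_cayley; case: w => s t; case: p => [? ?].
apply: cayley_eq; rewrite ?cE /= ?mxE /=;
  case: (v 0 0) (v 1 0) (v 2 0)=> [? ?] [? ?] [? ?] /=; ring.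
Qed.

(** A complex number moves past a vector of C^3 up to conjugation, so the two factors cancel on C^3.
    On C they multiply to the square of conj [w], which is [w]. *)
Lemma sigma3_x1_oct p v : sigma3_x1 (oct p v) = oct (w * p) v.
Proof.
rewrite /sigma3_x1 /omega; case: p => [? ?].
apply: cayley_eq; rewrite ?cE /= ?mxE /=;
  case: (v 0 0) (v 1 0) (v 2 0)=> [? ?] [? ?] [? ?] /=; by field: (omega_sqr R).
Qed.

Lemma sigma3_x2_oct p v : sigma3_x2 (oct p v) = oct (w * p) (w *: v).
Proof.
rewrite /sigma3_x2; case: w => s t; case: p => [? ?].
apply: cayley_eq; rewrite ?cE /= ?mxE /=;
  case: (v 0 0) (v 1 0) (v 2 0)=> [? ?] [? ?] [? ?] /=; ring.
Qed.

(** The eigenvalues of sigma_3 on the C^3-parts of x_1, x_2, x_3 are thus 1, [w] and conj [w]. They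
    are pairwise distinct, which later tells the three slots apart. *)
Lemma sigma3_x3_oct p v : sigma3_x3 (oct p v) = oct (w * p) (w^* *: v).
Proof.
rewrite /sigma3_x3; case: w => s t; case: p => [? ?].
apply: cayley_eq; rewrite ?cE /= ?mxE /=;
  case: (v 0 0) (v 1 0) (v 2 0)=> [? ?] [? ?] [? ?] /=; ring.
Qed.

Definition act a (Q : 'M[C]_3) x : O := oct (a * cproj x) (Q *m cvec x).

Lemma act_oct a Q p v : act a Q (oct p v) = oct (a * p) (Q *m v).
Proof. by rewrite /act cproj_oct cvec_oct. Qed.

Lemma act_linear a Q : linear (act a Q).
Proof.
move=> k x y; rewrite -[x]octK -[y]octK octZ octD !act_oct octZ octD.
by rewrite mulmxDr -scalemxAr mulrDr mulrCA.
Qed.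

Lemma act_comp a Q a' Q' x : act a Q (act a' Q' x) = act (a * a') (Q *m Q') x.
Proof. by rewrite {2 3}/act act_oct mulrA mulmxA. Qed.

Lemma act1 x : act 1 1%:M x = x.
Proof. by rewrite /act mul1r mul1mx octK. Qed.

Lemma act_inj a Q a' Q' : act a Q =1 act a' Q' -> a = a' /\ Q = Q'.
Proof.
move=> e; split.
  by have := e (oct 1 0); rewrite !act_oct !mulr1 => /oct_inj[].
apply/matrixP => i j; have := e (oct 0 (delta_mx j 0)).
by rewrite !act_oct -!colE => /oct_inj[_] /matrixP/(_ i 0); rewrite !mxE.
Qed.

Lemma hermE u v : herm u v = ((conjv v)^T *m u) 0 0.
Proof. by rewrite mxE; apply: eq_bigr => i _; rewrite !mxE mulrC. Qed.

Lemma conjvZ a v : conjv (a *: v) = a^* *: conjv v.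
Proof. exact: map_mxZ. Qed.

Lemma crossZ a b u v : cross (a *: u) (b *: v) = (a * b) *: cross u v.
Proof.
by apply/matrixP; apply: ord3P => j; rewrite (ord1 j) !mxE /=; ring.
Qed.

Lemma hermZ a b u v : herm (a *: u) (b *: v) = a * b^* * herm u v.
Proof.
by rewrite /herm mulr_sumr; apply: eq_bigr => i _; rewrite !mxE; ring.
Qed.

Section Unitary.
Variable Q : 'M[C]_3.
Hypothesis uQ : Q \is spectral.unitarymx.

Lemma unitarymxVl : (map_mx Num.conj Q^T) *m Q = 1%:M.
Proof. exact/mulmx1C/spectral.unitarymxP. Qed.

Lemma herm_unitary u v : herm (Q *m u) (Q *m v) = herm u v.
Proof.
rewrite !hermE /conjv map_mxM trmx_mul (map_trmx _ Q).
by rewrite -mulmxA (mulmxA _ Q) unitarymxVl mul1mx.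
Qed.

Lemma adj_unitary : \adj Q = \det Q *: map_mx Num.conj Q^T.
Proof.
rewrite -[LHS]mulmx1 -(spectral.unitarymxP uQ).
by rewrite mulmxA mul_adj_mx mul_scalar_mx.
Qed.

(** The transposed adjugate of a unitary [Q] is [\det Q] times the entrywise conjugate of [Q]. The
    outer conjugation turns the latter back into [Q], so the conjugated cross product is
    SU(3)-equivariant. *)
Lemma conjv_cross_unitary u v :
  conjv (cross (Q *m u) (Q *m v)) = (\det Q)^* *: (Q *m conjv (cross u v)).
Proof.
rewrite cross_mul adj_unitary /conjv map_mxM.
rewrite linearZ /= map_mxZ -scalemxAl; congr (_ *: (_ *m _)).
by apply/matrixP => i j; rewrite !mxE; apply: conjCK.
Qed.
End Unitary.

(* [slot b_i b_(i+1) b_(i+2) P] acts on [x_i]. *)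
Definition slot b c d (P : 'M[C]_3) := act (c * d^* ) (b^* *: P).

Section Slots.
Variables (P : 'M[C]_3) (b1 b2 b3 : C).
Hypotheses (uP : P \is spectral.unitarymx) (dP : \det P = 1).
Hypotheses (u1 : b1 * b1^* = 1) (u2 : b2 * b2^* = 1) (u3 : b3 * b3^* = 1).
Hypothesis b123 : b1 * b2 * b3 = 1.

Lemma slot_dot x y : cdot (slot b1 b2 b3 P x) (slot b1 b2 b3 P y) = cdot x y.
Proof.
rewrite -(octK x) -(octK y).
move: (cproj x) (cvec x) (cproj y) (cvec y) => p m q n.
rewrite /slot !act_oct !cdot_oct -!scalemxAl hermZ.
rewrite herm_unitary // conjCK [b1^* * _]mulrC u1 mul1r.
congr (complex.Re (_ + _)).
rewrite !rmorphM /= conjCK.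
transitivity ((b2 * b2^*) * (b3 * b3^*) * (p * q^*)); first by ring.
by rewrite u2 u3 !mul1r.
Qed.

(** Both sides are compared term by term. The terms in [p], [q] and [herm] match because the
    parameters have modulus one; the cross product term needs [\det P = 1] and conj b_1 = b_2
    b_3. *)
Lemma slot_tri x y :
  cconj (cmul (slot b2 b3 b1 P x) (slot b3 b1 b2 P y)) =
  slot b1 b2 b3 P (cconj (cmul x y)).
Proof.
have c1 : b1^* = b2 * b3 by rewrite -[LHS]mul1r -b123 -[RHS]mul1r -u1; ring.
rewrite -(octK x) -(octK y).
move: (cproj x) (cvec x) (cproj y) (cvec y) => p m q n.
rewrite /slot !act_oct !cmul_oct !cconj_oct act_oct.
rewrite -!scalemxAl hermZ herm_unitary // crossZ conjvZ.
rewrite conjv_cross_unitary // dP !rmorph1 scale1r mulmxN !mulmxDr -!scalemxAr.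
congr oct.
  rewrite !rmorphB !rmorphM /= !conjCK.
  transitivity ((b1 * b1^*) * b2 * b3^* * p^* * q^* - b2 * b3^* * (herm m n)^*).
    by ring.
  by rewrite u1 mul1r mulrBr !mulrA.
rewrite scalerN; congr (- _); rewrite !scalerDr !scalerA !rmorphM /= !conjCK.
congr (_ *: _ + _ *: _ + _ *: _).
- by rewrite -[RHS]mul1r -u3; ring.
- by rewrite -[RHS]mul1r -u2; ring.
- by rewrite c1.
Qed.
End Slots.
End Octonions.

(** * The homomorphism from SU(3) x U(1) x U(1) *)

Section Roots.
Variable R : realType.
Local Notation w := (omega R).

Lemma omega_sum : 1 + w + w^-1 = 0.
Proof.
rewrite -omega_mul; apply/eqP; rewrite eq_complex /=; apply/andP; split;
  apply/eqP; by field: (omega_sqr R).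
Qed.

Lemma cube_rootsE (z : R[i]) : (z \in [:: 1; w; w^-1]) = (z ^+ 3 == 1).
Proof.
rewrite !inE -[RHS]subr_eq0 -[z == 1]subr_eq0 -[z == w]subr_eq0.
rewrite -[z == _^-1]subr_eq0 orbA -!mulf_eq0; congr (_ == 0).
(* The right side is expanded by the elementary symmetric functions of 1, [w], [w^-1], the first two
   of which vanish by [omega_sum]. The last [ring] then sees the product of the three linear
   factors. *)
have -> : z ^+ 3 - 1 = z ^+ 3 - (1 + w + w^-1) * z ^+ 2
    + (w + w^-1 + w * w^-1) * z - w * w^-1.
  rewrite omega_sum mulfV ?omega_neq0 // [w + _ + _]addrC addrA omega_sum; ring.
ring.
Qed.

Lemma omega_neq1 : w != 1.
Proof.
by apply/eqP => e; have /eqP := omega_sum;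
  rewrite e invr1 -[1]/(1%:R) -!natrD pnatr_eq0.
Qed.

Lemma omega_neq_conj : w != w^*.
Proof.
rewrite -[w^*]/(conjc w) -omega_inv; apply/eqP => e.
have := omega_sum; rewrite -e => s; have := omega_mul R; rewrite -e => m.
have /eqP : w * (w - 1) = 0 by rewrite mulrBr m mulr1 subrr.
by rewrite mulf_eq0 subr_eq0 (negPf (omega_neq0 R)) (negPf omega_neq1).
Qed.

Lemma omega_conj_neq1 : w^* != 1.
Proof. by rewrite fmorph_eq1 omega_neq1. Qed.
End Roots.

Section Parametrization.
Variable R : realType.
Local Notation C := R[i].
Local Notation O := (cayley R).
Local Notation K := (SU C 3 * U1 C * U1 C)%type.
Implicit Types (X Y : jordan R) (g h : K).

Lemma eq_jact (f1 f2 f3 f1' f2' f3' : O -> O) X :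
  f1 =1 f1' -> f2 =1 f2' -> f3 =1 f3' -> jact f1 f2 f3 X = jact f1' f2' f3' X.
Proof. by move=> e1 e2 e3; rewrite /jact e1 e2 e3. Qed.

Lemma jact_comp (f1 f2 f3 f1' f2' f3' : O -> O) X :
  jact f1 f2 f3 (jact f1' f2' f3' X) =
  jact (f1 \o f1') (f2 \o f2') (f3 \o f3') X.
Proof. by rewrite /jact !jmxE. Qed.

Lemma slot_comp (b c d b' c' d' : C) P P' (x : O) :
  slot b c d P (slot b' c' d' P' x) =
  slot (b * b') (c * c') (d * d') (P *m P') x.
Proof.
rewrite /slot act_comp -scalemxAr -scalemxAl scalerA; congr (act _ (_ *: _) x);
  ring.
Qed.

Lemma slot1 (x : O) : slot 1 1 1 1%:M x = x.
Proof. by rewrite /slot rmorph1 mulr1 scale1r act1. Qed.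

Lemma U1P (z : U1 C) : val z * (val z)^* = 1.
Proof. by rewrite -normCK (eqP (valP z)) expr1n. Qed.

(** The parameter b_3: since b_1 b_2 has modulus one, its conjugate is its inverse, so b_1 b_2 b_3 =
    1. *)
Definition phi3 g : C := (val g.1.2 * val g.2)^*.

Lemma phi3P g : phi3 g * (phi3 g)^* = 1.
Proof.
rewrite /phi3 conjCK rmorphM -[RHS](U1P g.1.2) -[RHS]mulr1 -(U1P g.2) /=; ring.
Qed.

Lemma phi123 g : val g.1.2 * val g.2 * phi3 g = 1.
Proof. by rewrite -[phi3 g]mul1r -[RHS](phi3P g) mul1r /phi3 conjCK mulrC. Qed.

Definition phi_fun g : jordan R -> jordan R :=
  jact (slot (val g.1.2) (val g.2) (phi3 g) (val g.1.1))
       (slot (val g.2) (phi3 g) (val g.1.2) (val g.1.1))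
       (slot (phi3 g) (val g.1.2) (val g.2) (val g.1.1)).

Lemma phi_funM g h X : phi_fun (g * h)%g X = phi_fun g (phi_fun h X).
Proof.
have p3 : phi3 (g * h)%g = phi3 g * phi3 h.
  by rewrite /phi3 -rmorphM; congr (_^*); rewrite /= mulrACA.
by rewrite /phi_fun jact_comp p3; apply: eq_jact => x; rewrite /= slot_comp.
Qed.

Lemma phi_fun1 X : phi_fun 1%g X = X.
Proof.
have p3 : phi3 1%g = 1 by rewrite /phi3 mulr1 rmorph1.
rewrite /phi_fun p3 -[RHS]jmxK /jact /=.
by congr jmx; apply: slot1.
Qed.

Lemma phi_fun_linear g : linear (phi_fun g).
Proof. by apply: jact_linear; apply: act_linear. Qed.

Lemma phi_fun_bij g : bijective (phi_fun g).
Proof.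
by exists (phi_fun g^-1%g) => X; rewrite -phi_funM ?mulVg ?mulgV phi_fun1.
Qed.

Definition phi_lin g : linAut (jordan R) :=
  LinAut (phi_fun_linear g) (phi_fun_bij g).

Lemma phi_F4 g : phi_lin g \in F4_pred (R := R).
Proof.
have /andP[uP /eqP dP] := valP g.1.1.
have u1 := U1P g.1.2; have u2 := U1P g.2; have u3 := phi3P g.
have u123 := phi123 g.
(* The slot lemmas are used for all three cyclic rotations of the parameters. *)
have u231 : val g.2 * phi3 g * val g.1.2 = 1 by rewrite -u123; ring.
have u312 : phi3 g * val g.1.2 * val g.2 = 1 by rewrite -u123; ring.
apply/asboolP; apply: jact_jmul.
- exact: act_linear.
- exact: act_linear.
- exact: act_linear.
- exact: slot_dot.
- exact: slot_dot.
- exact: slot_dot.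
- exact: slot_tri.
- exact: slot_tri.
- exact: slot_tri.
Qed.

Definition phi_sub g : F4 R := Sub (phi_lin g) (phi_F4 g).

Lemma act_w3 a Q (x : O) : act a Q (w3_cayley x) = w3_cayley (act a Q x).
Proof. by rewrite -(octK x) !(w3_oct, act_oct) -scalemxAr. Qed.

Lemma act_sigma3_x1 a Q (x : O) : act a Q (sigma3_x1 x) = sigma3_x1 (act a Q x).
Proof. by rewrite -(octK x) !(sigma3_x1_oct, act_oct) mulrCA. Qed.

Lemma act_sigma3_x2 a Q (x : O) : act a Q (sigma3_x2 x) = sigma3_x2 (act a Q x).
Proof. by rewrite -(octK x) !(sigma3_x2_oct, act_oct) mulrCA -scalemxAr. Qed.

Lemma act_sigma3_x3 a Q (x : O) : act a Q (sigma3_x3 x) = sigma3_x3 (act a Q x).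
Proof. by rewrite -(octK x) !(sigma3_x3_oct, act_oct) mulrCA -scalemxAr. Qed.

Local Notation G := (subgrp (capg (centr (sigma3 R)) (centr (w3 R)))).

Lemma phi_centr g : phi_sub g \in capg (centr (sigma3 R)) (centr (w3 R)).
Proof.
apply/andP; split; rewrite centrE; apply/eqP/val_inj/linAutP => X /=.
  rewrite /phi_fun /sigma3_fun !jact_comp; apply: eq_jact => x /=.
  - exact: act_sigma3_x1.
  - exact: act_sigma3_x2.
  - exact: act_sigma3_x3.
by rewrite /phi_fun /w3_fun !jact_comp; apply: eq_jact => x /=; apply: act_w3.
Qed.

Definition phi g : G := Sub (phi_sub g) (phi_centr g).

Lemma phiM : {morph phi : g h / (g * h)%g}.
Proof. by move=> g h; apply/val_inj/val_inj/linAutP => X; apply: phi_funM. Qed.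

(** In the kernel the multipliers b_2 conj b_3 and b_3 conj b_1 on C equal 1, so the three
    parameters share one value z. Their product is 1, so z is a cube root of unity, and conj z P = E
    gives P = z E. *)
Lemma phi_eq1P g : reflect (phi g = 1%g) (g \in Z3 R).
Proof.
apply: (iffP (Z3P g)) => [[z z3 [gA' ga' gb']]|e].
  have gA : val g.1.1 = z%:M := gA'; have ga : val g.1.2 = z := ga'.
  have gb : val g.2 = z := gb'.
  have c3 : phi3 g = z.
    move: z3; rewrite cube_rootsE => /eqP z3.
    (* Both [z * z * phi3 g] and [z ^+ 3] equal 1, so [z * z] can be cancelled. *)
    have z0 : z * z != 0 by apply/eqP => z0; move/eqP: z3;
      rewrite !exprS mulrA z0 mul0r eq_sym oner_eq0.
    by apply: (mulfI z0); move: (phi123 g); rewrite ga gb => ->; rewrite -z3;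
      ring.
  apply/val_inj/val_inj/linAutP => X /=.
  have zz : z * z^* = 1 by rewrite -ga U1P.
  have s1 : slot z z z z%:M =1 (@id O).
    by move=> x; rewrite /slot zz scale_scalar_mx mulrC zz act1.
  by rewrite /phi_fun c3 gA ga gb -[RHS]jmxK /jact !s1.
have {}e X : phi_fun g X = X.
  by have /(congr1 (fun a : G => val (val a) X)) := e.
have e1 x : slot (val g.1.2) (val g.2) (phi3 g) (val g.1.1) x = x.
  by have /(congr1 (@jx1 R)) := e (jmx 0 0 0 x 0 0); rewrite !jmxE.
have e2 x : slot (val g.2) (phi3 g) (val g.1.2) (val g.1.1) x = x.
  by have /(congr1 (@jx2 R)) := e (jmx 0 0 0 0 x 0); rewrite !jmxE.
have [a1 Q1] := @act_inj R _ _ 1 1%:M (fun x => etrans (e1 x) (esym (act1 x))).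
have [a2 _] := @act_inj R _ _ 1 1%:M (fun x => etrans (e2 x) (esym (act1 x))).
have b23 : val g.2 = phi3 g.
  by rewrite -[LHS]mulr1 -(phi3P g) mulrCA a1 mulr1.
have b31 : phi3 g = val g.1.2.
  by rewrite -[LHS]mulr1 -(U1P g.1.2) mulrCA a2 mulr1.
have b21 := etrans b23 b31.
exists (val g.1.2).
  by rewrite cube_rootsE -(phi123 g) b31 b21 !exprS expr0 mulr1 mulrA.
rewrite b21; congr (_, _, _).
by rewrite -[LHS]scale1r -(U1P g.1.2) -scalerA Q1 scale_scalar_mx mulr1.
Qed.

End Parametrization.

(** * Automorphisms commuting with sigma_3 and w_3 *)

Section Commutant.
Variable R : realType.
Local Notation C := R[i].
Local Notation O := (cayley R).
Local Notation w := (omega R).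
Implicit Types (X Y : jordan R) (x y : O) (v : 'cV[C]_3) (r s : R).

Lemma scaler_eq_neq (c d : C) v : c != d -> c *: v = d *: v -> v = 0.
Proof.
move=> cd e; have /eqP : (c - d) *: v = 0 by rewrite scalerBl e subrr.
by rewrite scaler_eq0 subr_eq0 (negPf cd) => /eqP.
Qed.

Definition jE1 : jordan R := jmx 1 0 0 0 0 0.
Definition jE2 : jordan R := jmx 0 1 0 0 0 0.
Definition jE3 : jordan R := jmx 0 0 1 0 0 0.
Definition jX1 x : jordan R := jmx 0 0 0 x 0 0.
Definition jX2 x : jordan R := jmx 0 0 0 0 x 0.
Definition jX3 x : jordan R := jmx 0 0 0 0 0 x.
Definition jdiag r1 r2 r3 : jordan R := jmx r1 r2 r3 0 0 0.

Lemma oct0 : oct 0 0 = 0 :> O.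
Proof. by apply: cayley_eq; rewrite ?cE /= ?mxE /= ?oppr0. Qed.

Lemma mul0c x : cmul 0 x = 0.
Proof. by apply: cayley_eq; rewrite ?cE /=; ring. Qed.

Lemma mulc0 x : cmul x 0 = 0.
Proof. by apply: cayley_eq; rewrite ?cE /=; ring. Qed.

Lemma cdot0c x : cdot 0 x = 0.
Proof. by rewrite /cdot /=; ring. Qed.

Lemma cdotc0 x : cdot x 0 = 0.
Proof. by rewrite /cdot /=; ring. Qed.

Lemma cconj0 : cconj 0 = 0 :> O.
Proof. exact: linear0. Qed.

Definition simp0 := (mul0c, mulc0, cdot0c, cdotc0, cconj0, mul0r, mulr0,
  addr0, add0r, scaler0, scale0r, mul1r, mulr1, scale1r).

Lemma jscaleE r r1 r2 r3 x1 x2 x3 :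
  r *: jmx r1 r2 r3 x1 x2 x3 =
  jmx (r * r1) (r * r2) (r * r3) (r *: x1) (r *: x2) (r *: x3) :> jordan R.
Proof.
by apply: jordan_eq; rewrite -[r *: _]addr0 !jlinE !jmxE;
  rewrite /jxi1 /jxi2 /jxi3 /jx1 /jx2 /jx3 /= !mxE addr0.
Qed.

Lemma jaddE r1 r2 r3 x1 x2 x3 s1 s2 s3 y1 y2 y3 :
  jmx r1 r2 r3 x1 x2 x3 + jmx s1 s2 s3 y1 y2 y3 =
  jmx (r1 + s1) (r2 + s2) (r3 + s3) (x1 + y1) (x2 + y2) (x3 + y3) :> jordan R.
Proof.
by apply: jordan_eq; rewrite -[jmx r1 _ _ _ _ _]scale1r !jlinE !jmxE ?mul1r
  ?scale1r.
Qed.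

Lemma jmx_inj r1 r2 r3 x1 x2 x3 s1 s2 s3 y1 y2 y3 :
  jmx r1 r2 r3 x1 x2 x3 = jmx s1 s2 s3 y1 y2 y3 :> jordan R ->
  [/\ r1 = s1, r2 = s2 & r3 = s3] /\ [/\ x1 = y1, x2 = y2 & x3 = y3].
Proof.
move=> e; split; split.
- by have := congr1 (@jxi1 R) e; rewrite !jmxE.
- by have := congr1 (@jxi2 R) e; rewrite !jmxE.
- by have := congr1 (@jxi3 R) e; rewrite !jmxE.
- by have := congr1 (@jx1 R) e; rewrite !jmxE.
- by have := congr1 (@jx2 R) e; rewrite !jmxE.
- by have := congr1 (@jx3 R) e; rewrite !jmxE.
Qed.

Lemma half_fixed r : r = 2^-1 * r -> r = 0.
Proof.
move=> e; have : 2 * r - r = 0 by rewrite {1}e mulVKf ?subrr // pnatr_eq0.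
by rewrite mulr_natl mulr2n addrK.
Qed.

Lemma half_zero x : 0 = 2^-1 *: x -> x = 0.
Proof.
have half_neq0 : 2^-1 != 0 :> R by rewrite invr_eq0 pnatr_eq0.
by move=> e; rewrite -[x](scalerK half_neq0) -e scaler0.
Qed.

Lemma half_zero0 r : 0 = 2^-1 * r -> r = 0.
Proof.
by move/esym/eqP; rewrite mulf_eq0 invr_eq0 pnatr_eq0 => /eqP.
Qed.

(** E_2 annihilates x_2 and E_3 annihilates x_3, while both halve x_1; a diagonal entry would equal
    its own half or have half equal to 0. The slot x_1 is thus described by E_2 and E_3 alone, so an
    automorphism fixing them preserves it. *)
Lemma peirce1 r1 r2 r3 x1 x2 x3 (Y := jmx r1 r2 r3 x1 x2 x3 : jordan R) :
  jmul jE2 Y = 2^-1 *: Y -> jmul jE3 Y = 2^-1 *: Y -> Y = jX1 x1.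
Proof.
rewrite /jE2 /jE3 /jX1 /Y !jmulE !jscaleE !simp0.
move=> /jmx_inj[[e1 e2 _] [_ f2 _]] /jmx_inj[[_ _ e3] [_ _ f3]].
by rewrite (half_zero f2) (half_zero f3) (half_fixed e2) (half_fixed e3)
  (half_zero0 e1).
Qed.

Lemma peirce2 r1 r2 r3 x1 x2 x3 (Y := jmx r1 r2 r3 x1 x2 x3 : jordan R) :
  jmul jE3 Y = 2^-1 *: Y -> jmul jE1 Y = 2^-1 *: Y -> Y = jX2 x2.
Proof.
rewrite /jE3 /jE1 /jX2 /Y !jmulE !jscaleE !simp0.
move=> /jmx_inj[[_ e1 e2] [_ _ f2]] /jmx_inj[[e3 _ _] [f3 _ _]].
by rewrite (half_zero f2) (half_zero f3) (half_fixed e2) (half_fixed e3)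
  (half_zero0 e1).
Qed.

Lemma peirce3 r1 r2 r3 x1 x2 x3 (Y := jmx r1 r2 r3 x1 x2 x3 : jordan R) :
  jmul jE1 Y = 2^-1 *: Y -> jmul jE2 Y = 2^-1 *: Y -> Y = jX3 x3.
Proof.
rewrite /jE1 /jE2 /jX3 /Y !jmulE !jscaleE !simp0.
move=> /jmx_inj[[e1 _ e2] [f1 _ _]] /jmx_inj[[_ e3 _] [_ f3 _]].
by rewrite (half_zero f1) (half_zero f3) (half_fixed e1) (half_fixed e3)
  (half_zero0 e2).
Qed.
End Commutant.

(** * Complex linearity on C and on C^3 *)

Section LinearCharacterization.
Variable R : realType.
Local Notation C := R[i].
Local Notation O := (cayley R).
Local Notation w := (omega R).
Implicit Types (x y : O) (v : 'cV[C]_3).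

Lemma linear_additive (U V : lmodType R) (f : U -> V) :
  linear f -> {morph f : x y / x + y}.
Proof. by move=> l x y; rewrite -[x]scale1r l !scale1r. Qed.

Lemma linear_zero (U V : lmodType R) (f : U -> V) : linear f -> f 0 = 0.
Proof.
by move=> l; apply: (addrI (f 0)); rewrite -linear_additive // !addr0.
Qed.

Lemma linear_scale (U V : lmodType R) (f : U -> V) :
  linear f -> forall k u, f (k *: u) = k *: f u.
Proof. by move=> l k u; rewrite -[k *: u]addr0 l linear_zero // addr0. Qed.

(** As 1 and [w] span C over the reals, a real linear map commuting with [w] is complex linear. *)
Lemma complex_omega_span (z : C) : exists s t : R, z = s%:C%C + t%:C%C * w.
Proof.
(* Solved from the imaginary part sqrt 3 / 2 of [w]; adding [t / 2] below offsets its real part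
   -1/2. *)
pose t := complex.Im z * 2 / Num.sqrt 3.
exists (complex.Re z + t / 2), t; apply: complexRe_inj => /=.
  by field.
have s0 : Num.sqrt 3 != 0 :> R by rewrite lt0r_neq0 // sqrtr_gt0 ltr0n.
by rewrite /t; field.
Qed.

(** Commutation with w_3 makes [f] preserve C and C^3. Multiplication by [w] is then supplied by [s]
    on C and by w_3 on C^3. Leaving [c] free lets one statement cover the three slots of sigma_3. *)
Lemma act_of_commuting (f s : O -> O) (c : C) :
    linear f -> (forall x, f (w3_cayley x) = w3_cayley (f x)) ->
    (forall p v, s (oct p v) = oct (w * p) (c *: v)) ->
    (forall x, f (s x) = s (f x)) ->
  exists a Q, f =1 act a Q.
Proof.
move=> fl fw sE fs; have fD := linear_additive fl.
(* C is the fixed space of w_3, so its image consists of fixed vectors. *)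
have f1 p : f (oct p 0) = oct (cproj (f (oct p 0))) 0.
  have := fw (oct p 0); rewrite w3_oct scaler0; set y := f _.
  rewrite -(octK y) w3_oct => /oct_inj[_ /esym e].
  rewrite -[RHS]scale1r in e.
  by rewrite cproj_oct (scaler_eq_neq (omega_neq1 R) e).
(* C^3 is the kernel of 1 + w_3 + w_3^2. *)
have f2 v : f (oct 0 v) = oct 0 (cvec (f (oct 0 v))).
  have e : oct 0 v + w3_cayley (oct 0 v) + w3_cayley (w3_cayley (oct 0 v)) = 0.
    rewrite !w3_oct !octD !addr0 scalerA omega_mul -{1}[v]scale1r.
    by rewrite -!scalerDl omega_sum scale0r oct0.
  (* The three summands have the same C-part, so three times the C-part of [y] is 0. *)
  have := congr1 f e; rewrite 2!fD !fw linear_zero //; set y := f _.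
  rewrite -(octK y) !w3_oct !octD -oct0 => /oct_inj[/eqP + _].
  by rewrite cvec_oct -!mulr2n -mulrSr mulrn_eq0 => /eqP ->.
pose g p := cproj (f (oct p 0)); pose h v := cvec (f (oct 0 v)).
have gD : {morph g : p q / p + q}.
  move=> p q; have e : oct (p + q) 0 = oct p 0 + oct q 0 by rewrite octD addr0.
  by rewrite /g e fD f1 (f1 q) octD !cproj_oct.
have gR (r : R) p : g (r%:C%C * p) = r%:C%C * g p.
  have e : oct (r%:C%C * p) 0 = r *: oct p 0 by rewrite octZ scaler0.
  by rewrite /g e linear_scale // f1 octZ !cproj_oct.
have gw p : g (w * p) = w * g p.
  have := fs (oct p 0); rewrite sE scaler0 (f1 p) (f1 (w * p)) sE.
  by move=> /oct_inj[].
have hD : {morph h : u v / u + v}.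
  move=> u v; have e : oct 0 (u + v) = oct 0 u + oct 0 v by rewrite octD addr0.
  by rewrite /h e fD f2 (f2 v) octD !cvec_oct.
have hR (r : R) v : h (r%:C%C *: v) = r%:C%C *: h v.
  have e : oct 0 (r%:C%C *: v) = r *: oct 0 v by rewrite octZ mulr0.
  by rewrite /h e linear_scale // f2 octZ !cvec_oct.
have hw v : h (w *: v) = w *: h v.
  have := fw (oct 0 v); rewrite w3_oct (f2 v) (f2 (w *: v)) w3_oct.
  by move=> /oct_inj[].
have gZ p : g p = g 1 * p.
  have [s' [t ->]] := complex_omega_span p.
  have -> : s'%:C%C + t%:C%C * w = s'%:C%C * 1 + t%:C%C * w * 1 by ring.
  by rewrite gD -mulrA !gR gw; ring.
have hZ z v : h (z *: v) = z *: h v.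
  have [s' [t ->]] := complex_omega_span z.
  by rewrite !scalerDl hD hR -!scalerA hR hw.
exists (g 1), (\matrix_(i, j) h (delta_mx j 0) i 0) => x.
rewrite -(octK x); move: (cproj x) (cvec x) => p v.
rewrite act_oct -(addr0 p) -(add0r v) -octD fD f1 f2 octD.
rewrite !addr0 !add0r -/(g p) -/(h v) -gZ; congr oct.
have ve : v = v 0 0 *: delta_mx 0 0 + v 1 0 *: delta_mx 1 0 +
              v 2 0 *: delta_mx 2 0.
  by apply/matrixP; apply: ord3P => j; rewrite (ord1 j) !mxE /=; ring.
rewrite {1}ve !hD !hZ; apply/matrixP => i j; rewrite (ord1 j) !mxE sum3E !mxE.
ring.
Qed.
End LinearCharacterization.

(** * The idempotents E_1, E_2, E_3 are fixed *)

Section DiagonalIdempotents.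
Variable R : realType.
Local Notation C := R[i].
Local Notation O := (cayley R).
Local Notation w := (omega R).
Implicit Types (X Y : jordan R) (x y : O) (v m : 'cV[C]_3) (r s : R).

(** Applied to relations between sigma_3, w_3 and the identity, this kills every component on which
    the two eigenvalues differ. *)
Lemma oct_eigen (c1 c2 d1 d2 p : C) v :
  oct (c1 * p) (d1 *: v) = oct (c2 * p) (d2 *: v) ->
  (c1 != c2 -> p = 0) /\ (d1 != d2 -> v = 0).
Proof.
move=> /oct_inj[ep ev]; split=> [c12|d12]; last exact: scaler_eq_neq d12 ev.
have /eqP : (c1 - c2) * p = 0 by rewrite mulrBl ep subrr.
by rewrite mulf_eq0 subr_eq0 (negPf c12) => /eqP.
Qed.

Lemma jactE (f1 f2 f3 : O -> O) r1 r2 r3 x1 x2 x3 :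
  jact f1 f2 f3 (jmx r1 r2 r3 x1 x2 x3) = jmx r1 r2 r3 (f1 x1) (f2 x2) (f3 x3).
Proof. by rewrite /jact !jmxE. Qed.

Lemma jmx_ex X : exists r1 r2 r3 p1 v1 p2 v2 p3 v3,
  X = jmx r1 r2 r3 (oct p1 v1) (oct p2 v2) (oct p3 v3).
Proof.
exists (jxi1 X), (jxi2 X), (jxi3 X), (cproj (jx1 X)), (cvec (jx1 X)),
  (cproj (jx2 X)), (cvec (jx2 X)), (cproj (jx3 X)), (cvec (jx3 X)).
by rewrite !octK jmxK.
Qed.

Lemma sigma3E r1 r2 r3 (p1 p2 p3 : C) v1 v2 v3 :
  sigma3_fun (jmx r1 r2 r3 (oct p1 v1) (oct p2 v2) (oct p3 v3)) =
  jmx r1 r2 r3 (oct (w * p1) (1 *: v1)) (oct (w * p2) (w *: v2))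
    (oct (w * p3) (w^* *: v3)).
Proof.
by rewrite /sigma3_fun jactE sigma3_x1_oct sigma3_x2_oct sigma3_x3_oct scale1r.
Qed.

Lemma w3E r1 r2 r3 (p1 p2 p3 : C) v1 v2 v3 :
  w3_fun (jmx r1 r2 r3 (oct p1 v1) (oct p2 v2) (oct p3 v3)) =
  jmx r1 r2 r3 (oct (1 * p1) (w *: v1)) (oct (1 * p2) (w *: v2))
    (oct (1 * p3) (w *: v3)).
Proof. by rewrite /w3_fun jactE !w3_oct !mul1r. Qed.

(* The shape expected by [oct_eigen]. *)
Lemma jmx1E r1 r2 r3 (p1 p2 p3 : C) v1 v2 v3 :
  jmx r1 r2 r3 (oct p1 v1) (oct p2 v2) (oct p3 v3) =
  jmx r1 r2 r3 (oct (1 * p1) (1 *: v1)) (oct (1 * p2) (1 *: v2))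
    (oct (1 * p3) (1 *: v3)).
Proof. by rewrite !mul1r !scale1r. Qed.

Lemma idempotent_neq0 r : r * r = r -> r != 0 -> r = 1.
Proof. by move=> rr r0; apply: (mulfI r0); rewrite rr mulr1. Qed.

Lemma idempotents_sum0 r s :
  r * r = r -> s * s = s -> r + s = 0 -> r = 0 /\ s = 0.
Proof.
move=> rr ss /eqP; rewrite addr_eq0 => /eqP e.
suff s0 : s = 0 by rewrite e s0 oppr0.
move: rr; rewrite e mulrNN ss => /eqP; rewrite -addr_eq0 -mulr2n mulrn_eq0 //.
by move/eqP.
Qed.

Lemma scale_oct0_eq0 r m : m != 0 -> r *: oct 0 m = 0 -> r = 0.
Proof.
move=> m0; rewrite octZ -oct0 => /oct_inj[_ /eqP].
by rewrite scaler_eq0 (negPf m0) orbF => /eqP[].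
Qed.

Variable a : jordan R -> jordan R.
Hypotheses (al : linear a) (ai : injective a).
Hypothesis aM : forall X Y, a (jmul X Y) = jmul (a X) (a Y).
Hypothesis aS : forall X, a (sigma3_fun X) = sigma3_fun (a X).
Hypothesis aW : forall X, a (w3_fun X) = w3_fun (a X).

(** The image is fixed by w_3, which kills its C^3-parts, and by sigma_3, which kills its
    C-parts. *)
Lemma image_jdiag r1 r2 r3 : exists s1 s2 s3,
  a (jdiag r1 r2 r3) = jdiag s1 s2 s3.
Proof.
have [s1 [s2 [s3 [p1 [v1 [p2 [v2 [p3 [v3 e]]]]]]]]] :=
  jmx_ex (a (jdiag r1 r2 r3)).
have := aW (jdiag r1 r2 r3);
  rewrite {1}/jdiag -oct0 w3E !scaler0 !mulr0 oct0 -/(jdiag _ _ _).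
rewrite e w3E {1}jmx1E => /jmx_inj[_ [/oct_eigen[_ f1] /oct_eigen[_ f2]
  /oct_eigen[_ f3]]].
have := aS (jdiag r1 r2 r3);
  rewrite {1}/jdiag -oct0 sigma3E !scaler0 !mulr0 oct0 -/(jdiag _ _ _).
rewrite e sigma3E {1}jmx1E => /jmx_inj[_ [/oct_eigen[g1 _] /oct_eigen[g2 _]
  /oct_eigen[g3 _]]].
have w1 : 1 != w by rewrite eq_sym omega_neq1.
by exists s1, s2, s3; rewrite f1 ?f2 ?f3 ?g1 ?g2 ?g3 // oct0.
Qed.

Let a0 : a 0 = 0. Proof. exact: linear_zero. Qed.

(** A probe vector for the C^3-part of each slot; any nonzero vector would serve. *)
Let m1 : 'cV[C]_3 := const_mx 1.
Let m1_neq0 : m1 != 0.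
Proof. by apply/eqP => /matrixP/(_ 0 0)/eqP; rewrite !mxE oner_eq0. Qed.

Lemma jmul_jdiag r1 r2 r3 s1 s2 s3 x1 x2 x3 :
  jmul (jdiag r1 r2 r3) (jmx s1 s2 s3 x1 x2 x3) =
  jmx (r1 * s1) (r2 * s2) (r3 * s3) (2^-1 *: ((r2 + r3) *: x1))
    (2^-1 *: ((r3 + r1) *: x2)) (2^-1 *: ((r1 + r2) *: x3)).
Proof. by rewrite /jdiag jmulE !simp0. Qed.

Lemma jmul_jdiag2 r1 r2 r3 s1 s2 s3 :
  jmul (jdiag r1 r2 r3) (jdiag s1 s2 s3) = jdiag (r1 * s1) (r2 * s2) (r3 * s3).
Proof. by rewrite {2}/jdiag jmul_jdiag !scaler0. Qed.

Let sq r1 r2 r3 s1 s2 s3 : a (jdiag r1 r2 r3) = jdiag s1 s2 s3 ->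
  r1 * r1 = r1 -> r2 * r2 = r2 -> r3 * r3 = r3 ->
  [/\ s1 * s1 = s1, s2 * s2 = s2 & s3 * s3 = s3].
Proof.
move=> e e1 e2 e3; have := aM (jdiag r1 r2 r3) (jdiag r1 r2 r3).
by rewrite !jmul_jdiag2 e1 e2 e3 e jmul_jdiag2 => /jmx_inj[[<- <- <-] _].
Qed.

Let jmx0 : jmx 0 0 0 0 0 0 = 0 :> jordan R.
Proof. by rewrite -[RHS](scale0r (jmx 0 0 0 0 0 0)) jscaleE !simp0. Qed.

Let wVw : w^* * w = 1.
Proof. by rewrite mulrC; exact: omega_conj. Qed.

Lemma w3_jdiag r1 r2 r3 : w3_fun (jdiag r1 r2 r3) = jdiag r1 r2 r3.
Proof. by rewrite /jdiag -oct0 w3E !scaler0 !mulr0. Qed.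

(** Diagonal matrices are fixed by w_3, and injectivity of [a] carries this back to [X]. It shows
    below that the image of a probe keeps a nonzero C^3-part. *)
Let not_diag X : w3_fun X <> X -> forall s1 s2 s3, a X <> jdiag s1 s2 s3.
Proof.
by move=> wX s1 s2 s3 e; apply: wX; apply: ai; rewrite aW e w3_jdiag.
Qed.

Let m1_w : w *: m1 <> m1.
Proof.
move=> e; case/eqP: m1_neq0.
by apply: (scaler_eq_neq (omega_neq1 R)); rewrite scale1r.
Qed.

Let w_neqs : [/\ 1 != w, 1 != w^*, w != w^* & w * w != 1].
Proof.
split; first by rewrite eq_sym omega_neq1.
- by rewrite eq_sym omega_conj_neq1.
- exact: omega_neq_conj.
- by rewrite omega_mul invr_eq1 omega_neq1.
Qed.

(** The probe [X] in the C^3-part of x_1 satisfies sigma_3 X = X, and so does its image, which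
    leaves that image only a diagonal and a C^3-part [v1] in x_1. As E_1 annihilates [X], the image
    of E_1 annihilates [v1], which gives d_2 + d_3 = 0; the entries being idempotent, d_2 = d_3 = 0,
    and injectivity leaves d_1 = 1. *)
Lemma image_jE1 : a (jE1 R) = jE1 R.
Proof.
have [d1 [d2 [d3 e]]] := image_jdiag 1 0 0.
have {}e : a (jE1 R) = jdiag d1 d2 d3 := e.
have [q1 q2 q3] := sq e (mul1r 1) (mul0r 0) (mul0r 0).
pose X : jordan R := jmx 0 0 0 (oct 0 m1) (oct 0 0) (oct 0 0).
have [s1 [s2 [s3 [p1 [v1 [p2 [v2 [p3 [v3 eY]]]]]]]]] := jmx_ex (a X).
have SX : sigma3_fun X = X.
  by rewrite /X sigma3E !scaler0 !mulr0 scale1r.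
have := aS X; rewrite SX eY sigma3E {1}jmx1E => /jmx_inj[_].
case=> /oct_eigen[p10 v10] /oct_eigen[p20 v20] /oct_eigen[p30 v30].
have [w1 w2 w3' w4] := w_neqs; have w0 := omega_neq1 R.
have w5 := omega_conj_neq1 R.
rewrite p10 ?p20 ?p30 ?v20 ?v30 // 1?eq_sym // in eY.
have v0 : v1 != 0.
  apply/eqP => v0; apply: (@not_diag X _ s1 s2 s3).
    by rewrite /X w3E => /jmx_inj[_ [/oct_inj[_ h] _ _]]; apply: m1_w.
  by rewrite eY v0 oct0.
have := aM (jE1 R) X; rewrite /X oct0 -/(jdiag 1 0 0) jmul_jdiag !simp0 jmx0 a0.
rewrite -/(jE1 R) e -oct0 eY oct0 jmul_jdiag -jmx0.
case/jmx_inj=> _ [h _ _].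
have [z1 z2] := idempotents_sum0 q2 q3 (scale_oct0_eq0 v0 (half_zero h)).
rewrite z1 z2 in e *.
rewrite (idempotent_neq0 q1) //; apply/eqP => dk.
have /(congr1 (@jxi1 R)) : jE1 R = 0 by apply: ai; rewrite e dk a0 -jmx0.
by rewrite -jmx0 !jmxE => /eqP; rewrite oner_eq0.
Qed.

(** The slot x_2 is singled out by sigma_3 X = w_3 X: only on its C^3-part do the eigenvalues of
    sigma_3 and w_3 agree. *)
Lemma image_jE2 : a (jE2 R) = jE2 R.
Proof.
have [d1 [d2 [d3 e]]] := image_jdiag 0 1 0.
have {}e : a (jE2 R) = jdiag d1 d2 d3 := e.
have [q1 q2 q3] := sq e (mul0r 0) (mul1r 1) (mul0r 0).
pose X : jordan R := jmx 0 0 0 (oct 0 0) (oct 0 m1) (oct 0 0).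
have [s1 [s2 [s3 [p1 [v1 [p2 [v2 [p3 [v3 eY]]]]]]]]] := jmx_ex (a X).
have SX : sigma3_fun X = w3_fun X.
  by rewrite /X sigma3E w3E !scaler0 !mulr0.
have := congr1 a SX; rewrite aS aW eY sigma3E w3E => /jmx_inj[_].
case=> /oct_eigen[p10 v10] /oct_eigen[p20 v20] /oct_eigen[p30 v30].
have [w1 w2 w3' w4] := w_neqs; have w0 := omega_neq1 R.
have w5 := omega_conj_neq1 R.
rewrite p10 ?p20 ?p30 ?v30 ?v10 // 1?eq_sym // in eY.
have v0 : v2 != 0.
  apply/eqP => v0; apply: (@not_diag X _ s1 s2 s3).
    by rewrite /X w3E => /jmx_inj[_ [_ /oct_inj[_ h] _]]; apply: m1_w.
  by rewrite eY v0 oct0.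
have := aM (jE2 R) X; rewrite /X oct0 -/(jdiag 0 1 0) jmul_jdiag !simp0 jmx0 a0.
rewrite -/(jE2 R) e -oct0 eY oct0 jmul_jdiag -jmx0.
case/jmx_inj=> _ [_ h _].
have [z1 z2] := idempotents_sum0 q3 q1 (scale_oct0_eq0 v0 (half_zero h)).
rewrite z1 z2 in e *.
rewrite (idempotent_neq0 q2) //; apply/eqP => dk.
have /(congr1 (@jxi2 R)) : jE2 R = 0 by apply: ai; rewrite e dk a0 -jmx0.
by rewrite -jmx0 !jmxE => /eqP; rewrite oner_eq0.
Qed.

(** The slot x_3 is singled out by sigma_3 w_3 X = X: only on its C^3-part are the eigenvalues of
    sigma_3 and w_3 inverse to each other. *)
Lemma image_jE3 : a (jE3 R) = jE3 R.
Proof.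
have [d1 [d2 [d3 e]]] := image_jdiag 0 0 1.
have {}e : a (jE3 R) = jdiag d1 d2 d3 := e.
have [q1 q2 q3] := sq e (mul0r 0) (mul0r 0) (mul1r 1).
pose X : jordan R := jmx 0 0 0 (oct 0 0) (oct 0 0) (oct 0 m1).
have [s1 [s2 [s3 [p1 [v1 [p2 [v2 [p3 [v3 eY]]]]]]]]] := jmx_ex (a X).
have SX : sigma3_fun (w3_fun X) = X.
  by rewrite /X w3E sigma3E !scalerA wVw scale1r !scaler0 !mulr0.
have := congr1 a SX; rewrite aS aW eY w3E sigma3E !scalerA !mulrA !mulr1 !mul1r
  [in RHS]jmx1E => /jmx_inj[_].
case=> /oct_eigen[p10 v10] /oct_eigen[p20 v20] /oct_eigen[p30 v30].
have [w1 w2 w3' w4] := w_neqs; have w0 := omega_neq1 R.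
have w5 := omega_conj_neq1 R.
rewrite p10 ?p20 ?p30 ?v10 ?v20 // 1?eq_sym // in eY.
have v0 : v3 != 0.
  apply/eqP => v0; apply: (@not_diag X _ s1 s2 s3).
    by rewrite /X w3E => /jmx_inj[_ [_ _ /oct_inj[_ h]]]; apply: m1_w.
  by rewrite eY v0 oct0.
have := aM (jE3 R) X; rewrite /X oct0 -/(jdiag 0 0 1) jmul_jdiag !simp0 jmx0 a0.
rewrite -/(jE3 R) e -oct0 eY oct0 jmul_jdiag -jmx0.
case/jmx_inj=> _ [_ _ h].
have [z1 z2] := idempotents_sum0 q1 q2 (scale_oct0_eq0 v0 (half_zero h)).
rewrite z1 z2 in e *.
rewrite (idempotent_neq0 q3) //; apply/eqP => dk.
have /(congr1 (@jxi3 R)) : jE3 R = 0 by apply: ai; rewrite e dk a0 -jmx0.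
by rewrite -jmx0 !jmxE => /eqP; rewrite oner_eq0.
Qed.
End DiagonalIdempotents.

(** * Triality, recovery of the parameters, and surjectivity *)

Section Surjectivity.
Variable R : realType.
Local Notation C := R[i].
Local Notation O := (cayley R).
Local Notation w := (omega R).
Local Notation K := (SU C 3 * U1 C * U1 C)%type.
Implicit Types (X Y : jordan R) (x y : O) (v m : 'cV[C]_3) (r s : R).

(** Pairs of basis vectors give the entries of the conjugate transpose of [Q] times [Q]; a one-sided
    inverse of a square matrix is two-sided. *)
Lemma unitary_of_herm (Q : 'M[C]_3) :
  (forall u v, herm (Q *m u) (Q *m v) = herm u v) -> Q \is spectral.unitarymx.
Proof.
move=> hQ; apply/spectral.unitarymxP/mulmx1C/matrixP => i j.
have := hQ (delta_mx j 0) (delta_mx i 0); rewrite -!colE !hermE.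
move=> h; rewrite !mxE; transitivity (((conjv (col i Q))^T *m col j Q) 0 0).
  by rewrite mxE; apply: eq_bigr => k _; rewrite !mxE.
rewrite h mxE (bigD1 i) //= big1 => [|k ki]; rewrite !mxE.
  by rewrite !eqxx rmorph1 mul1r andbT addr0.
by rewrite (negPf ki) rmorph0 mul0r.
Qed.

Lemma det_unitary (Q : 'M[C]_3) : Q \is spectral.unitarymx ->
  \det Q * (\det Q)^* = 1.
Proof.
move=> uQ; have := congr1 determinant (spectral.unitarymxP uQ).
by rewrite det_mulmx det1 det_map_mx det_tr.
Qed.

Lemma unit_of_dot (a : C) Q (one := oct 1 0 : O) :
  cdot (act a Q one) (act a Q one) = cdot one one -> a * a^* = 1.
Proof.
rewrite /one !act_oct mulmx0 mulr1 !cdot_oct /herm sum3E !mxE !mul0r !addr0.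
by case: a => s t /= h; apply: complexRe_inj => /=; [rewrite h; ring|ring].
Qed.

(** Triality is specialized: the pair (1, 1) gives a_1, the pairs (1, v) and (v, 1) give Q_3 and
    Q_2, the C-part of (u, v) gives unitarity, and the C^3-part for two basis vectors gives the
    determinant. *)
Lemma triality_params (a1 a2 a3 : C) Q1 Q2 Q3 :
    a2 * a2^* = 1 -> a3 * a3^* = 1 ->
    (forall x y, cconj (cmul (act a2 Q2 x) (act a3 Q3 y)) =
                 act a1 Q1 (cconj (cmul x y))) ->
  [/\ a1 = (a2 * a3)^*, Q2 = a3 *: Q1, Q3 = a2^* *: Q1,
      Q1 \is spectral.unitarymx & \det Q1 = a2 * a3^*].
Proof.
move=> u2 u3 tri.
have {}tri p u q v :
    (a2 * p * (a3 * q) - herm (Q2 *m u) (Q3 *m v))^* =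
      a1 * (p * q - herm u v)^* /\
    (a2 * p) *: (Q3 *m v) + (a3 * q)^* *: (Q2 *m u) +
      conjv (cross (Q2 *m u) (Q3 *m v)) =
      Q1 *m (p *: v + q^* *: u + conjv (cross u v)).
  have := tri (oct p u) (oct q v).
  rewrite !act_oct !cmul_oct !cconj_oct act_oct.
  by move=> /oct_inj[-> /eqP]; rewrite mulmxN eqr_opp => /eqP.
have herm0 (u : 'cV[C]_3) : herm u 0 = 0.
  by rewrite hermE /conjv map_mx0 trmx0 mul0mx mxE.
have herm0' (u : 'cV[C]_3) : herm 0 u = 0 by rewrite hermE mulmx0 mxE.
have cross0 (u : 'cV[C]_3) : cross u 0 = 0.
  by apply/matrixP; apply: ord3P => i; rewrite (ord1 i) !mxE /= !mulr0 subrr.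
have cross0' (u : 'cV[C]_3) : cross 0 u = 0.
  by apply/matrixP; apply: ord3P => i; rewrite (ord1 i) !mxE /= !mul0r subrr.
have conjv0 : conjv 0 = 0 :> 'cV[C]_3 by rewrite /conjv map_mx0.
have e1 : a1 = (a2 * a3)^*.
  have [+ _] := tri 1 0 1 0; rewrite !mulmx0 herm0 !mulr1 !subr0.
  by rewrite rmorph1 mulr1.
have eqM (A B : 'M[C]_3) : (forall v, A *m v = B *m v) -> A = B.
  by move=> AB; apply/matrixP => i j; have := AB (delta_mx j 0);
    rewrite -!colE => /matrixP/(_ i 0); rewrite !mxE.
have e3 : Q3 = a2^* *: Q1.
  apply: eqM => v; have [_] := tri 1 0 0 v.
  rewrite !mulmx0 !scaler0 !cross0' !conjv0 !addr0 mulr1 scale1r => e.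
  by rewrite -scalemxAl -e scalerA mulrC u2 scale1r.
have e2 : Q2 = a3 *: Q1.
  apply: eqM => v; have [_] := tri 0 v 1 0.
  rewrite !mulmx0 !scaler0 !cross0 !conjv0 !addr0 mulr1 !add0r rmorph1.
  rewrite scale1r => e.
  by rewrite -scalemxAl -e scalerA u3 scale1r.
have uQ : Q1 \is spectral.unitarymx.
  apply: unitary_of_herm => u v; have [+ _] := tri 0 u 0 v.
  rewrite e1 e2 e3 !mulr0 !sub0r -!scalemxAl hermZ conjCK !rmorphN mulrN.
  move/oppr_inj; rewrite -rmorphM => /(can_inj (@conjCK _)) e.
  have ua : a2 * a3 * (a2 * a3)^* = 1.
    transitivity ((a2 * a2^*) * (a3 * a3^*)); first by ring.
    by rewrite u2 u3 mulr1.
  have a0 : a2 * a3 != 0.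
    by apply/eqP => a0; move/eqP: ua; rewrite a0 mul0r eq_sym oner_eq0.
  by apply: (mulfI a0); rewrite -e; congr (_ * _); rewrite mulrC.
split=> //.
have ud := det_unitary uQ.
pose e i : 'cV[C]_3 := delta_mx i 0.
have ce : conjv (cross (e 0) (e 1)) = e 2.
  apply/matrixP; apply: ord3P => i; rewrite (ord1 i) !mxE /=; ring.
have [_] := tri 0 (e 0) 0 (e 1).
rewrite e2 e3 -!scalemxAl crossZ conjvZ conjv_cross_unitary // ce !mulr0.
rewrite rmorph0 !scale0r !add0r scalerA => k.
(* By [k] this scalar fixes [Q1 *m e 2], which is nonzero because [Q1] preserves [herm]. *)
have k1 : (a3 * a2^*)^* * (\det Q1)^* = 1.
  apply/eqP; apply/negPn/negP => k0.
  have Qe0 : Q1 *m e 2 = 0 by apply: (scaler_eq_neq k0); rewrite scale1r.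
  have := herm_unitary uQ (e 2) (e 2); rewrite Qe0 herm0.
  rewrite /herm sum3E !mxE /= !mul0r !add0r mul1r rmorph1 => /eqP.
  by rewrite eq_sym oner_eq0.
by rewrite -[LHS]mulr1 -k1 mulrCA ud mulr1 rmorphM /= conjCK mulrC.
Qed.

Lemma phi_surj_params (a2 a3 : C) (Q : 'M[C]_3) :
    a2 * a2^* = 1 -> a3 * a3^* = 1 -> Q \is spectral.unitarymx ->
    \det Q = a2 * a3^* ->
  exists g : K, phi_fun g =1
    jact (act (a2 * a3)^* Q) (act a2 (a3 *: Q)) (act a3 (a2^* *: Q)).
Proof.
move=> u2 u3 uQ dQ.
(* With this choice [b *: Q] has determinant [b ^+ 3 * \det Q = 1]. *)
pose b : C := 3.-root (\det Q)^*.
have b3 : b ^+ 3 = (\det Q)^* by rewrite rootCK.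
have norm1 (z : C) : z * z^* = 1 -> `|z| = 1.
  by move=> z1; apply/eqP; rewrite -(@pexpr_eq1 _ _ 2) // normCK z1.
have nb : `|b| = 1.
  apply/eqP; rewrite -(@pexpr_eq1 _ _ 3) // -normrX b3; apply/eqP/norm1.
  by rewrite conjCK mulrC det_unitary.
have ub : b * b^* = 1 by rewrite -normCK nb expr1n.
have nc : `|a3^* * b| = 1 by rewrite normrM nb norm_conjC norm1 // mulr1.
have uP : SU_pred (b *: Q).
  apply/andP; split.
    apply/spectral.unitarymxP; rewrite linearZ /= map_mxZ -scalemxAl -scalemxAr.
    by rewrite (spectral.unitarymxP uQ) scalerA ub scale1r.
  by rewrite detZ b3 mulrC det_unitary.
have Ub : U1_pred b by apply/eqP.
have Uc : U1_pred (a3^* * b) by apply/eqP.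
pose g : K := (Sub (b *: Q) uP, Sub b Ub, Sub (a3^* * b) Uc).
exists g => X; have p3 : phi3 g = a2 * b.
  (* From the value of [\det Q], b^3 = a_3 conj a_2. Substituting this turns conj (b_1 b_2) into a_2
     b. *)
  have a3E : a3 = b ^+ 3 * a2.
    by rewrite b3 dQ rmorphM /= conjCK mulrAC [a2^* * _]mulrC u2 mul1r.
  rewrite /phi3 /= !rmorphM /= conjCK.
  transitivity ((b * b^* ) ^+ 2 * (a2 * b)); first by rewrite {1}a3E; ring.
  by rewrite ub expr1n mul1r.
have bb : b^* * b = 1 by rewrite mulrC.
rewrite /phi_fun p3 /=; apply: eq_jact => x; rewrite /slot !scalerA.
- rewrite bb scale1r; congr (act _ Q x); rewrite !rmorphM /=.
  by rewrite -[RHS]mul1r -ub; ring.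
- by rewrite rmorphM /= conjCK -mulrA bb mulr1 -[a2 * b * _]mulrA ub mulr1.
- rewrite !rmorphM /= conjCK -[a2^* * _ * _]mulrA bb mulr1.
  congr (act _ _ x); rewrite -[RHS]mulr1 -ub; ring.
Qed.

Section Commuting.
Variable a : jordan R -> jordan R.
Hypotheses (al : linear a) (ai : injective a).
Hypothesis aM : forall X Y, a (jmul X Y) = jmul (a X) (a Y).
Hypothesis aS : forall X, a (sigma3_fun X) = sigma3_fun (a X).
Hypothesis aW : forall X, a (w3_fun X) = w3_fun (a X).

Let f1 x := jx1 (a (jX1 x)).
Let f2 x := jx2 (a (jX2 x)).
Let f3 x := jx3 (a (jX3 x)).

(** As [a] fixes E_2 and E_3, it maps their common 1/2-eigenvectors to common 1/2-eigenvectors, and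
    [peirce1] applies. *)
Let aX1 x : a (jX1 x) = jX1 (f1 x).
Proof.
have aE2 := image_jE2 al ai aM aS aW; have aE3 := image_jE3 al ai aM aS aW.
have h E : a E = E -> jmul E (jX1 x) = 2^-1 *: jX1 x ->
    jmul E (a (jX1 x)) = 2^-1 *: a (jX1 x).
  by move=> aE e; rewrite -{1}aE -aM e linear_scale.
rewrite -[a (jX1 x)]jmxK; apply: peirce1; rewrite jmxK; apply: h => //;
  by rewrite jscaleE !jmul_jdiag !simp0.
Qed.

Let aX2 x : a (jX2 x) = jX2 (f2 x).
Proof.
have aE3 := image_jE3 al ai aM aS aW; have aE1 := image_jE1 al ai aM aS aW.
have h E : a E = E -> jmul E (jX2 x) = 2^-1 *: jX2 x ->
    jmul E (a (jX2 x)) = 2^-1 *: a (jX2 x).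
  by move=> aE e; rewrite -{1}aE -aM e linear_scale.
rewrite -[a (jX2 x)]jmxK; apply: peirce2; rewrite jmxK; apply: h => //;
  by rewrite jscaleE !jmul_jdiag !simp0.
Qed.

Let aX3 x : a (jX3 x) = jX3 (f3 x).
Proof.
have aE1 := image_jE1 al ai aM aS aW; have aE2 := image_jE2 al ai aM aS aW.
have h E : a E = E -> jmul E (jX3 x) = 2^-1 *: jX3 x ->
    jmul E (a (jX3 x)) = 2^-1 *: a (jX3 x).
  by move=> aE e; rewrite -{1}aE -aM e linear_scale.
rewrite -[a (jX3 x)]jmxK; apply: peirce3; rewrite jmxK; apply: h => //;
  by rewrite jscaleE !jmul_jdiag !simp0.
Qed.

Let jmx_split r1 r2 r3 x1 x2 x3 : jmx r1 r2 r3 x1 x2 x3 =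
  r1 *: jE1 R + r2 *: jE2 R + r3 *: jE3 R + jX1 x1 + jX2 x2 + jX3 x3.
Proof. by rewrite !jscaleE !jaddE !simp0. Qed.

Lemma commuting_jact X : a X = jact f1 f2 f3 X.
Proof.
have aD := linear_additive al; have aZ := linear_scale al.
rewrite -{1}(jmxK X) jmx_split 5!aD 3!aZ aX1 aX2 aX3.
rewrite (image_jE1 al ai aM aS aW) (image_jE2 al ai aM aS aW).
by rewrite (image_jE3 al ai aM aS aW) -jmx_split.
Qed.

Let f1_linear : linear f1.
Proof.
move=> k x y; rewrite /f1; have -> : jX1 (k *: x + y) = k *: jX1 x + jX1 y.
  by rewrite jscaleE jaddE !simp0.
by rewrite al jlinE.
Qed.

(** Maps vanishing at 0 make [jact] preserve the slot x_1, so commutation restricts to it. It is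
    applied to both sigma_3 and w_3. *)
Let f1_act (g1 g2 g3 : O -> O) :
  (forall X, a (jact g1 g2 g3 X) = jact g1 g2 g3 (a X)) ->
  g1 0 = 0 -> g2 0 = 0 -> g3 0 = 0 -> forall x, f1 (g1 x) = g1 (f1 x).
Proof.
move=> ag g10 g20 g30 x; rewrite /f1.
have -> : jX1 (g1 x) = jact g1 g2 g3 (jX1 x) by rewrite jactE ?g10 ?g20 ?g30.
by rewrite ag /jact jmxE.
Qed.

Let f2_linear : linear f2.
Proof.
move=> k x y; rewrite /f2; have -> : jX2 (k *: x + y) = k *: jX2 x + jX2 y.
  by rewrite jscaleE jaddE !simp0.
by rewrite al jlinE.
Qed.

Let f2_act (g1 g2 g3 : O -> O) :
  (forall X, a (jact g1 g2 g3 X) = jact g1 g2 g3 (a X)) ->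
  g1 0 = 0 -> g2 0 = 0 -> g3 0 = 0 -> forall x, f2 (g2 x) = g2 (f2 x).
Proof.
move=> ag g10 g20 g30 x; rewrite /f2.
have -> : jX2 (g2 x) = jact g1 g2 g3 (jX2 x) by rewrite jactE ?g10 ?g20 ?g30.
by rewrite ag /jact jmxE.
Qed.

Let f3_linear : linear f3.
Proof.
move=> k x y; rewrite /f3; have -> : jX3 (k *: x + y) = k *: jX3 x + jX3 y.
  by rewrite jscaleE jaddE !simp0.
by rewrite al jlinE.
Qed.

Let f3_act (g1 g2 g3 : O -> O) :
  (forall X, a (jact g1 g2 g3 X) = jact g1 g2 g3 (a X)) ->
  g1 0 = 0 -> g2 0 = 0 -> g3 0 = 0 -> forall x, f3 (g3 x) = g3 (f3 x).
Proof.
move=> ag g10 g20 g30 x; rewrite /f3.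
have -> : jX3 (g3 x) = jact g1 g2 g3 (jX3 x) by rewrite jactE ?g10 ?g20 ?g30.
by rewrite ag /jact jmxE.
Qed.

Let w30 : w3_cayley 0 = 0 :> O.
Proof. exact/linear_zero/w3_linear. Qed.

Let s10 : sigma3_x1 0 = 0 :> O.
Proof. exact/linear_zero/sigma3_x1_linear. Qed.

Let s20 : sigma3_x2 0 = 0 :> O.
Proof. exact/linear_zero/sigma3_x2_linear. Qed.

Let s30 : sigma3_x3 0 = 0 :> O.
Proof. exact/linear_zero/sigma3_x3_linear. Qed.

Let half_neq0 : 2^-1 != 0 :> R.
Proof. by rewrite invr_eq0 pnatr_eq0. Qed.

Lemma commuting_phi : exists g : K, phi_fun g =1 a.
Proof.
have [a1 [Q1 fE1]] : exists a1 Q1, f1 =1 act a1 Q1.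
  apply: (@act_of_commuting _ _ (@sigma3_x1 R) 1) => //.
  - exact: (f1_act aW).
  - by move=> p v; rewrite sigma3_x1_oct scale1r.
  - exact: (f1_act aS).
have [a2 [Q2 fE2]] : exists a2 Q2, f2 =1 act a2 Q2.
  apply: (@act_of_commuting _ _ (@sigma3_x2 R) w) => //.
  - exact: (f2_act aW).
  - exact: sigma3_x2_oct.
  - exact: (f2_act aS).
have [a3 [Q3 fE3]] : exists a3 Q3, f3 =1 act a3 Q3.
  apply: (@act_of_commuting _ _ (@sigma3_x3 R) w^* ) => //.
  - exact: (f3_act aW).
  - exact: sigma3_x3_oct.
  - exact: (f3_act aS).
(* The product of [jX2 x] and [jX3 y] lies in the slot x_1 and carries the Cayley product, so
   multiplicativity of [a] becomes triality. *)
have tri x y : cconj (cmul (act a2 Q2 x) (act a3 Q3 y)) =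
               act a1 Q1 (cconj (cmul x y)).
  have jm (u v : O) : jmul (jX2 u) (jX3 v) = 2^-1 *: jX1 (cconj (cmul u v)).
    by rewrite jmulE jscaleE !simp0.
  have := aM (jX2 x) (jX3 y).
  rewrite aX2 aX3 !jm linear_scale // aX1 fE1 fE2 fE3.
  by move/(scalerI half_neq0)/jmx_inj=> [_ [->]].
(* The square of [jX2] at the Cayley unit is diagonal, hence fixed by [a]; so the image of the unit
   under [f2] has the same norm. *)
have u2 : a2 * a2^* = 1.
  apply: (@unit_of_dot _ Q2); rewrite -fE2.
  have jm (x y : O) : jmul (jX2 x) (jX2 y) = jdiag (cdot x y) 0 (cdot x y).
    by rewrite jmulE !simp0.
  have := aM (jX2 (oct 1 0)) (jX2 (oct 1 0)); rewrite aX2 !jm => e.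
  set c := cdot (oct 1 0) (oct 1 0) in e *.
  have := commuting_jact (jdiag c 0 c).
  by rewrite e jactE => /jmx_inj[[->]].
have u3 : a3 * a3^* = 1.
  apply: (@unit_of_dot _ Q3); rewrite -fE3.
  have jm (x y : O) : jmul (jX3 x) (jX3 y) = jdiag (cdot x y) (cdot x y) 0.
    by rewrite jmulE !simp0.
  have := aM (jX3 (oct 1 0)) (jX3 (oct 1 0)); rewrite aX3 !jm => e.
  set c := cdot (oct 1 0) (oct 1 0) in e *.
  have := commuting_jact (jdiag c c 0).
  by rewrite e jactE => /jmx_inj[[->]].
have [e1 e2 e3 uQ dQ] := triality_params u2 u3 tri.
have [g gE] := phi_surj_params u2 u3 uQ dQ.
exists g => X; rewrite gE commuting_jact; apply: eq_jact => x.
- by rewrite fE1 e1.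
- by rewrite fE2 e2.
- by rewrite fE3 e3.
Qed.
End Commuting.

Local Notation G := (subgrp (capg (centr (sigma3 R)) (centr (w3 R)))).

Lemma phi_surj (al : G) : exists g, phi g = al.
Proof.
have /andP[] := valP al; rewrite !centrE => /eqP aS /eqP aW.
have /asboolP aM := valP (val al).
have [g gE] : exists g : K, phi_fun g =1 val (val al).
  apply: commuting_phi => //.
  - exact: linAut_linear.
  - exact/bij_inj/linAut_bij.
  - by move=> X; have /(congr1 (fun b : F4 R => val b X)) := aS.
  - by move=> X; have /(congr1 (fun b : F4 R => val b X)) := aW.
by exists g; apply/val_inj/val_inj/linAutP.
Qed.
End Surjectivity.

Theorem theorem4p4p1 (R : realType) :
  isomorphic
    (subgrp (capg (centr (sigma3 R)) (centr (w3 R))))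
    (quotg (Z3 R)).
Proof.
by apply: (first_isomorphism (@phiM R) (@phi_surj R)) => g /phi_eq1P.
Qed.
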